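(* Let $q\in(1,2]$ and let $\mathcal{G}:L^q(\Omega)\to[0,\infty]$ be the generative prior (defined in the context), where $Z:\Theta\to\mathbb{R}^{N_c}$ is linear and bounded and the functionals $\mathcal{J}_l:M^l\to[0,\infty]$ are weak* lower semicontinuous with $\mathcal{J}_l(0)=0$. Then $\mathcal{G}$ is proper (not identically $\infty$) and coercive (i.e. $\|v_m\|_q\to\infty$ implies $\mathcal{G}(v_m)\to\infty$).
   Context: Domains and measures. $\Omega,\Sigma\subset\mathbb{R}^d$ are bounded domains, i.e. bounded, open and simply connected sets, with $0\in\Sigma$. For sets, $A-B=\{x-y: x\in A,\ y\in B\}$. Put $\Omega^0=\Omega$, $\Omega^1=\Omega-\Sigma$ and $\Omega^{l+1}=\Omega^l-\Sigma$. For $\omega\subset\mathbb{R}^d$, $C_0(\omega)$ is the closure of $C_c(\omega)$ in the uniform norm, and $(\mathcal{M}(\omega),\|\cdot\|_{\mathcal M})$ is its dual space (finite Radon measures with the total variation norm). For bounded $\omega$, a function $f\in L^q(\omega)$ is identified with the element $\phi\mapsto\int_\omega f\phi\,dx$ of $\mathcal{M}(\omega)$; $\|\cdot\|_q$ is the $L^q$-norm. Convolution. For $l\ge1$, $\mu\in\mathcal{M}(\Omega^l)$ and $g\in L^2(\Sigma)$, $\mu*g$ denotes the unique function, belonging to $L^q(\Omega^{l-1})$ for every $q\in(1,2]$, with $\int_{\Omega^{l-1}}(\mu*g)\phi\,dx=\int_{\Omega^l}\int_\Sigma\tilde\phi(x+y)g(x)\,dx\,d\mu(y)$ for all $\phi\in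 C_c(\Omega^{l-1})$, where $\tilde\phi$ is the extension of $\phi$ by zero to $\mathbb{R}^d$. (It is known that such a function exists and that $\|\mu*g\|_q\le C\|\mu\|_{\mathcal M}\|g\|_2$ with a constant $C$ independent of $\mu,g$.) Network. Let $L\in\mathbb{N}$ be the number of layers, $N_1,\dots,N_L\in\mathbb{N}$ and $N_0=1$. For $l=1,\dots,L$ let $E^l\subset\{1,\dots,N_l\}\times\{1,\dots,N_{l-1}\}$ be such that for each $n\in\{1,\dots,N_l\}$ there is some $k$ with $(n,k)\in E^l$. Set $M^l=\mathcal{M}(\Omega^l)^{N_l}$, $M=M^1\times\dots\times M^L$, $\Theta^l=L^2(\Sigma)^{|E^l|}$ with elements $\theta^l=(\theta^l_{n,k})_{(n,k)\in E^l}$, and $\Theta=\Theta^1\times\dots\times\Theta^L$. Define $\mu^1*_1\theta^1=\sum_{n=1}^{N_1}\mu^1_n*\theta^1_{n,1}\in L^q(\Omega)$ and, for $l=2,\dots,L$, $\mu^l*_l\theta^l=\big(\sum_{n:(n,k)\in E^l}\mu^l_n*\theta^l_{n,k}\big)_{k=1}^{N_{l-1}}\in M^{l-1}$. Generative prior. With $Z$ ($N_c\in\mathbb{N}$) and $\mathcal{J}_l$, $l=1,\dots,L-1$, as in the claim, put $\|\mu\|_{\mathcal M}=\sum_{l=1}^L\sum_{n=1}^{N_l}\|\mu^l_n\|_{\mathcal M}$ and $G(\mu,\theta)=\|\mu\|_{\mathcal M}+\sum_{l=2}^L\mathcal{J}_{l-1}(\mu^{l-1}-\mu^l*_l\theta^l)$.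 For $v\in L^q(\Omega)$ let $F(v)$ be the set of all $(\mu,\theta)\in M\times\Theta$ with $v=\mu^1*_1\theta^1$, $\|\theta^l_{n,k}\|_2\le1$ for all $l$ and all $(n,k)\in E^l$, and $Z\theta=0$. Then $\mathcal{G}(v)=\inf_{(\mu,\theta)\in F(v)}G(\mu,\theta)$, with $\mathcal{G}(v)=\infty$ if $F(v)=\emptyset$. *)

(* Defs.v *)
From HB Require Import structures.
From mathcomp Require Import all_boot all_order all_algebra.
From mathcomp Require Import all_classical all_reals all_analysis.
From mathcomp Require Import measurable_realfun lra.
Set Implicit Arguments.
Unset Strict Implicit.
Unset Printing Implicit Defensive.
Import Order.TTheory GRing.Theory Num.Theory.
Import numFieldNormedType.Exports.
Local Open Scope classical_set_scope.
Local Open Scope ring_scope.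

(* R^d is 'rV[R]_d with its Borel sigma-algebra. *)
HB.instance Definition _ (R : realType) (d : nat) :=
  isMeasurable.Build (sigma_display (@open 'rV[R]_d)) 'rV[R]_d
    (@sigma_algebra0 _ setT open) (@sigma_algebraC _ open)
    (@sigma_algebra_bigcup _ setT open).

Section lebesgue_rV.
Context {R : realType}.

Lemma open_measurable_rV d (U : set 'rV[R]_d) : open U -> measurable U.
Proof. exact: sub_gen_smallest. Qed.

Lemma continuous_measurable_rV d (f : 'rV[R]_d -> R) :
  continuous f -> measurable_fun setT f.
Proof.
move=> /continuousP cf; apply: (measurability _ (RGenOInfty.measurableE R)).
move=> _ [_ [a ->]] <-; rewrite setTI; apply: (@open_measurable_rV d); apply: cf.
by rewrite set_itvE; exact: open_gt.
Qed.

Lemma rV_ball_cover d (U : set 'rV[R]_d) : open U ->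
  exists2 B : nat -> set 'rV[R]_d, U = \bigcup_n B n &
   forall n, B n = set0 \/ exists c e, B n = ball c e.
Proof.
move=> oU.
pose c (q : 'rV[rat]_d) : 'rV[R]_d := map_mx ratr q.
pose B (n : nat) : set 'rV[R]_d :=
  if (unpickle n : option ('rV[rat]_d * nat)) is Some p then
    if `[< ball (c p.1) p.2.+1%:R^-1 `<=` U >] then ball (c p.1) p.2.+1%:R^-1
    else set0
  else set0.
exists B; last first.
  move=> n; rewrite /B; case: unpickle => [p|]; last by left.
  case: asboolP => _; last by left.
  by right; exists (c p.1), p.2.+1%:R^-1.
apply/seteqP; split=> [x Ux|x [n _]]; last first.
  rewrite /B; case: unpickle => [p|//].
  by case: asboolP => // /[apply].
have /nbhs_ballP[e /= e0 eU] : nbhs x U by exact: open_nbhs_nbhs.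
have e20 : 0 < e / 2 by rewrite divr_gt0.
have [N _ /(_ N (leqnn _)) /= Ne] := near_infty_natSinv_lt (PosNum e20).
have N0 : 0 < N.+1%:R^-1 :> R by rewrite invr_gt0.
have /choice[q qx] (i : 'I_d) : exists q : rat, ball (x 0 i) N.+1%:R^-1 (ratr q).
  have [] := @dense_rat R (ball (x 0 i) N.+1%:R^-1).
  - by exists (x 0 i); exact: ballxx.
  - exact: ball_open.
  by move=> y [xy [r _ ry]]; exists r; rewrite ry.
exists (pickle (\row_i q i, N)) => //.
rewrite /B pickleK /=.
have cx : ball x N.+1%:R^-1 (c (\row_i q i)).
  by split => // i j; rewrite !mxE (ord1 i); exact: qx.
rewrite asboolT; first exact: ball_sym.
move=> y cy; apply: eU.
apply: (@le_ball _ _ _ (N.+1%:R^-1 + N.+1%:R^-1)).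
  by rewrite [leRHS]splitr lerD// ltW.
exact: ball_triangle cx cy.
Qed.

Definition rV_cons d (p : measurableTypeR R * 'rV[R]_d) : 'rV[R]_d.+1 :=
  \row_j oapp (p.2 0) p.1 (unlift 0 j).

Definition rV_uncons d (v : 'rV[R]_d.+1) : measurableTypeR R * 'rV[R]_d :=
  (v 0 0, \row_j v 0 (lift 0 j)).

Lemma rV_consK d : cancel (@rV_cons d) (@rV_uncons d).
Proof.
move=> [x v]; rewrite /rV_uncons /rV_cons mxE unlift_none /=; congr pair.
by apply/rowP => j; rewrite !mxE liftK.
Qed.

Lemma measurable_rV_cons d : measurable_fun setT (@rV_cons d).
Proof.
apply: (@measurability _ _ _ _ _ _ (@open 'rV[R]_d.+1)) => //.
move=> _ [U oU <-]; rewrite setTI.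
have [B -> Bball] := rV_ball_cover oU.
rewrite preimage_bigcup; apply: bigcup_measurable => n _.
have [->|[c [e ->]]] := Bball n; first by rewrite preimage_set0.
have [e0|e0] := leP e 0.
  rewrite (_ : ball _ _ = set0) ?preimage_set0//.
  by apply/seteqP; split=> // x [/=]; rewrite ltNge e0.
rewrite (_ : _ @^-1` _ =
    ball (c 0 0 : R) e `*` ball (\row_j c 0 (lift 0 j) : 'rV[R]_d) e); last first.
  apply/seteqP; split=> -[x v] /=.
    move=> [_ h]; split=> /=.
      by have := h 0 0; rewrite mxE unlift_none.
    split=> // i j; rewrite (ord1 i) mxE.
    by have := h 0 (lift 0 j); rewrite mxE liftK.
  move=> [/= hx [_ hv]]; split=> // i j; rewrite (ord1 i) mxE.
  case: unliftP => [k ->|->] //=.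
  by have := hv 0 k; rewrite mxE.
apply: measurableX; first exact: measurable_ball.
apply: (@open_measurable_rV d); exact: ball_open.
Qed.

Lemma measurable_rV_uncons d : measurable_fun setT (@rV_uncons d).
Proof.
apply/measurable_fun_pairP; split.
  apply: (@continuous_measurable_rV d.+1); exact: coord_continuous.
apply: (@measurability _ _ _ _ _ _ (@open 'rV[R]_d)) => //.
move=> _ [U oU <-]; rewrite setTI; apply: (@open_measurable_rV d.+1).
move: U oU; apply/continuousP => v A /= /nbhs_ballP[e e0 eA].
apply/nbhs_ballP; exists e => // w [_ vw]; apply: eA; split => // i j.
by rewrite !mxE.
Qed.

Section lebesgue_consR.
Context d (m : {sigma_finite_measure set 'rV[R]_d -> \bar R}).

Definition lebesgue_cons : set 'rV[R]_d.+1 -> \bar R :=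
  pushforward (lebesgue_measure \x m)%E (@rV_cons d).

Let mcons := @measurable_rV_cons d.

Let lebesgue_cons0 : lebesgue_cons set0 = 0%E.
Proof. exact: measure0. Qed.

Let lebesgue_cons_ge0 A : (0 <= lebesgue_cons A)%E.
Proof. exact: measure_ge0. Qed.

Let lebesgue_cons_sigma_additive : semi_sigma_additive lebesgue_cons.
Proof. exact: measure_semi_sigma_additive. Qed.

HB.instance Definition _ := isMeasure.Build _ _ _ lebesgue_cons
  lebesgue_cons0 lebesgue_cons_ge0 lebesgue_cons_sigma_additive.

Let lebesgue_cons_sigma_finite : sigma_finite setT lebesgue_cons.
Proof.
have /sigma_finiteP[F [TF ndF Foo]] := sigma_finiteT (@lebesgue_measure R).
have /sigma_finiteP[G [TG ndG Goo]] := sigma_finiteT m.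
exists (fun n => @rV_uncons d @^-1` (F n `*` G n)).
  apply/seteqP; split => // v _.
  have [n _ Fn] : (\bigcup_i F i) (rV_uncons v).1 by rewrite -TF.
  have [k _ Gk] : (\bigcup_i G i) (rV_uncons v).2 by rewrite -TG.
  exists (maxn n k) => //; split.
    by move: Fn; exact/subsetPset/ndF/leq_maxl.
  by move: Gk; exact/subsetPset/ndG/leq_maxr.
move=> n; have [mF Fn] := Foo n; have [mG Gn] := Goo n; split.
  rewrite -[X in measurable X]setTI; apply: measurable_rV_uncons => //.
  exact: measurableX.
rewrite /lebesgue_cons /pushforward -comp_preimage.
rewrite (_ : _ \o _ = id); last by apply/funext => p; exact: rV_consK.
by rewrite preimage_id product_measure1E// lte_mul_pinfty// ge0_fin_numE.
Qed.

HB.instance Definition _ := Measure_isSigmaFinite.Build _ _ _ lebesgue_cons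
  lebesgue_cons_sigma_finite.
End lebesgue_consR.

(* The d-fold product of the Lebesgue measure of R, transported along the
   identification of R * R^d with R^(d+1). *)
Fixpoint lebesgue_rV d : {sigma_finite_measure set 'rV[R]_d -> \bar R} :=
  if d is d'.+1 then lebesgue_cons (lebesgue_rV d') else dirac (0 : 'rV[R]_0).

Lemma lebesgue_rV_box d (a b : 'I_d -> R) : (forall i, a i <= b i) ->
  let B := [set v : 'rV[R]_d | forall i, a i < v 0 i <= b i] in
  measurable B /\ lebesgue_rV d B = (\prod_i (b i - a i))%:E.
Proof.
elim: d a b => [|d IH] a b ab /=.
  rewrite (_ : mkset _ = setT); last by apply/seteqP; split => // v _ [].
  by rewrite big_ord0 diracT.
have [mB lB] := IH (a \o lift 0) (b \o lift 0) (fun i => ab _).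
set B := [set v | _] in mB lB.
have BE : [set v : 'rV[R]_d.+1 | forall i, a i < v 0 i <= b i] =
    @rV_uncons d @^-1` (`]a 0, b 0] `*` B).
  apply/seteqP; split=> v /=.
    by move=> h; split => [|i]; rewrite /= ?in_itv ?mxE /=.
  move=> [+ h] i; rewrite in_itv /= => h0.
  by case: (unliftP 0 i) => [j ->|->//]; have := h j; rewrite mxE.
rewrite BE; split.
  rewrite -[X in measurable X]setTI; apply: measurable_rV_uncons => //.
  exact: measurableX.
rewrite /= /lebesgue_cons /pushforward -comp_preimage.
rewrite (_ : _ \o _ = id); last by apply/funext => p; exact: rV_consK.
rewrite preimage_id product_measure1E//= lB lebesgue_measure_itv /= lte_fin.
rewrite big_ord_recl EFinM; case: ltP => // ba.
have -> : a 0 = b 0 by apply/le_anti; rewrite ab ba.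
by rewrite subrr.
Qed.

End lebesgue_rV.

Section domains.
Context {R : realType} {d : nat}.
Implicit Types A B : set 'rV[R]_d.

Definition path_connected A := A !=set0 /\
  forall x y, A x -> A y -> exists g : R -> 'rV[R]_d,
    [/\ {within `[0, 1], continuous g}, g @` `[0, 1] `<=` A, g 0 = x & g 1 = y].

(* Every loop g in A (which is path connected, hence nonempty) contracts to its
   base point inside A, with fixed end points. *)
Definition simply_connected A := path_connected A /\
  forall g : R -> 'rV[R]_d, {within `[0, 1], continuous g} ->
    g @` `[0, 1] `<=` A -> g 0 = g 1 ->
    exists h : R * R -> 'rV[R]_d,
    [/\ {within `[0, 1] `*` `[0, 1], continuous h},
        h @` (`[0, 1] `*` `[0, 1]) `<=` A,
        forall t, 0 <= t <= 1 -> h (0, t) = g t /\ h (1, t) = g 0 &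
        forall s, 0 <= s <= 1 -> h (s, 0) = g 0 /\ h (s, 1) = g 0].

Definition bounded_domain A := [/\ bounded_set A, open A & simply_connected A].

Definition set_diff A B := [set x - y | x in A & y in B].

Lemma open_set_diff A B : open A -> open (set_diff A B).
Proof.
move=> oA.
rewrite (_ : set_diff A B = \bigcup_(y in B) ((fun z => z + y) @^-1` A)).
  apply: bigcup_open => y _; suff /continuousP : continuous (fun z : 'rV[R]_d => z + y) by exact.
  by move=> z; apply: continuousD; [exact: cvg_id|exact: cst_continuous].
apply/seteqP; split=> [_ [x Ax [y By <-]]|z [y By /= Azy]].
  by exists y => //=; rewrite subrK.
by exists (z + y) => //; exists y => //; rewrite addrK.
Qed.

End domains.

Record openSet (R : realType) (d : nat) :=
  OpenSet { open_carrier :> set 'rV[R]_d; openP : open open_carrier }.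

Section spaces.
Context {R : realType} {d : nat}.
Implicit Types w : openSet R d.

Definition diff_open w (A : set 'rV[R]_d) : openSet R d :=
  OpenSet (open_set_diff (B := A) (@openP _ _ w)).

Definition leb_on w : {measure set 'rV[R]_d -> \bar R} :=
  mrestr (lebesgue_rV d) (open_measurable_rV (@openP _ _ w)).

(* Elements of L^q(w) are represented by Borel functions on R^d; only their
   values on w matter, and two of them denote the same element of L^q(w) when
   they agree almost everywhere for leb_on w. *)
Definition Lq w (q : R) (q1 : (1 <= q%:E)%E) := LfunType (leb_on w) q1.

Lemma exponent_ge1 (q : R) : 1 < q <= 2 -> (1 <= q%:E)%E.
Proof. by move=> /andP[/ltW q1 _]; rewrite lee_fin. Qed.

Definition Lq_norm w (q : R) (f : 'rV[R]_d -> R) : \bar R :=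
  ('N[leb_on w]_(q%:E)[EFin \o f])%E.

Definition L2 w := Lq w (lee1n 2).

(* Functions of C_c(w) and C_0(w) are extended by zero to the whole of R^d; as w
   is open the extensions are continuous. *)
Definition Cc w : set ('rV[R]_d -> R) :=
  [set phi | [/\ continuous phi, compact (closure [set x | phi x != 0]) &
                 closure [set x | phi x != 0] `<=` w]].

Definition C0_set w : set ('rV[R]_d -> R) :=
  [set phi | forall e, 0 < e ->
     exists2 psi, Cc w psi & forall x, `|phi x - psi x| <= e].

Lemma Cc_submod w : Cc w 0 /\
  forall (a : R) (f g : 'rV[R]_d -> R), Cc w f -> Cc w g -> Cc w (a *: f + g).
Proof.
split.
  rewrite /Cc /= (_ : mkset _ = set0) ?closure0; last first.
    by apply/seteqP; split => // x /=; rewrite eqxx.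
  by split => //; [exact: cst_continuous|exact: compact0].
move=> a f g [cf kf sf] [cg kg sg].
have sub : closure [set x | (a *: f + g) x != 0] `<=`
    closure [set x | f x != 0] `|` closure [set x | g x != 0].
  rewrite -closureU; apply: closure_subset => x /=.
  apply: contra_neqP => /not_orP[/negP/negPn/eqP fx /negP/negPn/eqP gx].
  by rewrite -[LHS]/(a * f x + g x) fx gx mulr0 addr0.
split.
- by move=> x; apply: continuousD; [apply: continuousM; [exact: cst_continuous|exact: cf]|exact: cg].
- apply: subclosed_compact sub; first exact: closed_closure.
  exact: compactU.
- by move=> x /sub[/sf|/sg].
Qed.

Definition C0_pred w : {pred ('rV[R]_d -> R)} := mem (C0_set w).

Lemma C0_submod_closed w : submod_closed (C0_pred w).
Proof.
have [Cc0 CcD] := Cc_submod w; split.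
  by rewrite inE => e e0; exists 0 => // x; rewrite subrr normr0 ltW.
move=> a f g; rewrite !inE => fC gC e e0.
have a0 : 0 < `|a| + 1 by rewrite ltr_wpDl.
have [f' Cf' ff'] := fC (e / 2 / (`|a| + 1)) (divr_gt0 (divr_gt0 e0 (ltr0n _ 2)) a0).
have [g' Cg' gg'] := gC (e / 2) (divr_gt0 e0 (ltr0n _ 2)).
exists (a *: f' + g'); first exact: CcD.
move=> x.
rewrite (_ : _ - _ = a * (f x - f' x) + (g x - g' x)); last first.
  by rewrite -[LHS]/(a * f x + g x - (a * f' x + g' x)) mulrBr opprD addrACA.
rewrite (le_trans (ler_normD _ _))// [leRHS]splitr lerD//.
rewrite normrM (@le_trans _ _ ((`|a| + 1) * (e / 2 / (`|a| + 1))))//.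
  by rewrite ler_pM// lerDl.
by rewrite mulrC divfK// gt_eqF.
Qed.

HB.instance Definition _ w := GRing.isSubmodClosed.Build _ _ (C0_pred w)
  (C0_submod_closed w).

Record C0 w := MkC0 { C0_fun :> 'rV[R]_d -> R; C0P : C0_fun \in C0_pred w }.

HB.instance Definition _ w := [isSub for @C0_fun w].
HB.instance Definition _ w := [Choice of C0 w by <:].
HB.instance Definition _ w := [SubChoice_isSubLmodule of C0 w by <:].

(* M(w): the bounded linear functionals on C_0(w), with the dual norm. *)
Definition bounded_linear_set w : set (C0 w -> R) :=
  [set m | linear (m : C0 w -> R^o) /\
    exists c, forall phi : C0 w, (forall x, `|phi x| <= 1) -> `|m phi| <= c].

Definition dual_pred w : {pred (C0 w -> R)} := mem (@bounded_linear_set w).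

Lemma dual_zmod_closed w : zmod_closed (@dual_pred w).
Proof.
split.
  rewrite inE; split; first by move=> a f g /=; rewrite scaler0 addr0.
  by exists 0 => phi _; rewrite normr0.
move=> m m'; rewrite !inE => -[lm [c mc]] [lm' [c' mc']]; split.
  move=> a f g; rewrite !fctE lm lm' scalerBr opprD addrACA //.
exists (c + c') => phi phi1; rewrite !fctE (le_trans (ler_normB _ _))//.
by rewrite lerD ?mc ?mc'.
Qed.

HB.instance Definition _ w := GRing.isZmodClosed.Build _ (@dual_pred w)
  (@dual_zmod_closed w).

Record dualC0 w := MkDual { dual_fun :> C0 w -> R; dualP : dual_fun \in @dual_pred w }.

HB.instance Definition _ w := [isSub for @dual_fun w].
HB.instance Definition _ w := [Choice of dualC0 w by <:].
HB.instance Definition _ w := [SubChoice_isSubZmodule of dualC0 w by <:].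

Definition dual_norm w (m : dualC0 w) : R :=
  sup [set `|m phi| | phi in [set phi : C0 w | forall x, `|phi x| <= 1]].

(* The weak* topology of M(w)^n = (C_0(w)^n)^*: the coarsest one for which all
   the evaluations m |-> m_i(phi) are continuous. *)
Definition weak_star w n := initial_topology
  (fun m : {ffun 'I_n -> dualC0 w} =>
     (fun p : 'I_n * C0 w => m p.1 p.2) : {ptws ('I_n * C0 w) -> R}).

Definition weak_star_lsc w n (J : {ffun 'I_n -> dualC0 w} -> \bar R) :=
  @lower_semicontinuous (weak_star w n) R J.

(* The functional phi |-> \int_w f phi identified with f. The default value 0 is
   used only when this is not a bounded functional, which does not happen for
   f in L^1(w), see embedE; for bounded w this covers all of L^q(w), q >= 1. *)
Definition embed w (f : 'rV[R]_d -> R) : dualC0 w :=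
  insubd 0 (fun phi : C0 w => \int[leb_on w]_x (f x * phi x)).


Lemma C0_continuous w (phi : C0 w) : continuous phi.
Proof.
have := C0P phi; rewrite inE => phiC x.
apply/(@cvgrPdist_le _ _ _ (nbhs x) (nbhs_filter x)) => e e0.
have e3 : 0 < e / 3 by rewrite divr_gt0.
have [psi [cpsi _ _] psiE] := phiC _ e3.
have /(_ _ (nbhsx_ballx (psi x) _ e3)) := cpsi x.
apply: (@filterS _ (nbhs x) (nbhs_filter x)) => y /= /ltW xy.
rewrite (_ : phi x - phi y = (phi x - psi x) + (psi x - psi y) + (psi y - phi y)); last first.
  by rewrite !addrA subrK addrNK.
rewrite (_ : e = e / 3 + e / 3 + e / 3); last by lra.
apply: (le_trans (ler_normD _ _)); apply: lerD; last by rewrite distrC; exact: psiE.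
by apply: (le_trans (ler_normD _ _)); apply: lerD.
Qed.

Lemma C0_bounded w (phi : C0 w) : exists c, forall x, `|phi x| <= c.
Proof.
have := C0P phi; rewrite inE => /(_ _ ltr01)[psi [cpsi kpsi _] psiE].
have : compact (psi @` closure [set x | psi x != 0]).
  apply: continuous_compact => //; exact: continuous_subspaceT.
move=> /compact_bounded[M [_ /(_ (`|M| + 1))]].
rewrite (le_lt_trans (ler_norm _)) ?ltrDl// => /(_ isT) Mpsi.
exists (1 + (`|M| + 1)) => x.
rewrite -[phi x](subrK (psi x)) (le_trans (ler_normD _ _))// lerD//.
have [->|psix] := eqVneq (psi x) 0; first by rewrite normr0 addr_ge0.
by apply: Mpsi; exists x => //; exact: subset_closure.
Qed.

Lemma C0_integrable w (f : 'rV[R]_d -> R) (phi : C0 w) :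
  f \in Lfun (leb_on w) 1%E ->
  (leb_on w).-integrable setT (EFin \o (fun x => f x * phi x)).
Proof.
move=> /Lfun1_integrable fi.
have [c phic] := C0_bounded phi.
have mphi : measurable_fun setT phi.
  by apply: (@continuous_measurable_rV _ d); exact: C0_continuous.
have bphi : [bounded phi x | x in [set: 'rV[R]_d]].
  exists `|c|; split; first exact: num_real.
  by move=> x xc y _; rewrite /= (le_trans (phic y))// (le_trans (ler_norm _))// ltW.
have := @integrableMl _ _ _ (leb_on w) _ measurableT _ _ fi mphi bphi.
by [].
Qed.

Lemma embedE w (f : 'rV[R]_d -> R) (phi : C0 w) :
  f \in Lfun (leb_on w) 1%E ->
  embed w f phi = \int[leb_on w]_x (f x * phi x).
Proof.
move=> f1; rewrite -[LHS]/(val (embed w f) phi) /embed insubdK//= inE.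
split=> [a g h|].
  rewrite -[RHS]/(a * _ + _) -RintegralZl//; last exact: C0_integrable.
  rewrite -RintegralD//; last 2 first.
  - have := integrableZl measurableT a (C0_integrable g f1).
    by [].
  - exact: C0_integrable.
  apply: eq_Rintegral => x _.
  by rewrite -[LHS]/(f x * (a * g x + h x)) mulrDr mulrCA.
exists (\int[leb_on w]_x `|f x|) => g g1.
have fgi := C0_integrable g f1.
rewrite (le_trans (le_normr_Rintegral _ fgi))//.
apply: le_Rintegral => //.
- exact: integrable_norm.
- by apply: integrable_norm => //; exact/Lfun1_integrable.
- by move=> x _; rewrite normrM ler_piMr.
Qed.

End spaces.

Section network.
Context {R : realType} {d : nat}.
Variables (Omega Sigma : openSet R d).

Fixpoint layer (l : nat) : openSet R d :=
  if l is l'.+1 then diff_open (layer l') Sigma else Omega.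

(* f is the function m * g. The functions y |-> \int_Sigma phi(x + y) g(x) dx
   vanish outside w - Sigma and belong to C_0(w - Sigma), so that their integral
   with respect to m is the value of the functional m. *)
Definition is_conv (w : openSet R d) (m : dualC0 (diff_open w Sigma))
    (g : 'rV[R]_d -> R) (f : 'rV[R]_d -> R) : Prop :=
  (forall q : R, 1 < q <= 2 -> f \in Lfun (leb_on w) q%:E) /\
  forall phi, Cc w phi ->
    exists2 psi : C0 (diff_open w Sigma),
      (forall y, psi y = \int[leb_on Sigma]_x (phi (x + y) * g x)) &
      \int[leb_on w]_x (f x * phi x) = m psi.

(* xget selects the function m * g, which is unique almost everywhere on w. *)
Definition conv (w : openSet R d) (m : dualC0 (diff_open w Sigma))
    (g : 'rV[R]_d -> R) : 'rV[R]_d -> R := xget 0 [set f | is_conv m g f].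

(* There are L + 1 >= 1 layers; the index l : 'I_L.+1 stands for the layer l + 1,
   so that mu l, theta (l, _) and E l are mu^(l+1), theta^(l+1) and E^(l+1). *)
Variables (L : nat) (N : nat -> nat).

(* N_l, with N_0 = 1 *)
Definition width (l : nat) := if l is l'.+1 then N l'.+1 else 1%N.

Variable E : forall l : 'I_L.+1, {set 'I_(width l.+1) * 'I_(width l)}.

Definition edge (l : 'I_L.+1) := {e | e \in E l}.

Definition Theta := {ffun {l : 'I_L.+1 & edge l} -> L2 Sigma}.

Definition measures :=
  forall l : 'I_L.+1, {ffun 'I_(width l.+1) -> dualC0 (layer l.+1)}.

(* (mu^(l+1) *_(l+1) theta^(l+1))_k *)
Definition layer_conv (m : measures) (theta : Theta) (l : 'I_L.+1)
    (k : 'I_(width l)) : 'rV[R]_d -> R :=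
  \sum_(e : edge l | (val e).2 == k)
     conv (m l (val e).1) (theta (Tagged edge e)).

(* The indices of two consecutive layers l + 1 and l + 2. *)
Definition inner (l : 'I_L) : 'I_L.+1 := Ordinal (leqW (ltn_ord l)).
Definition outer (l : 'I_L) : 'I_L.+1 := Ordinal (ltn_ord l : l.+1 < L.+1)%N.

Definition penalties :=
  forall l : 'I_L, {ffun 'I_(width l.+1) -> dualC0 (layer l.+1)} -> \bar R.

Variables (J : penalties) (Nc : nat) (Z : {linear Theta -> 'rV[R]_Nc}).

(* All norms of the finite product Theta of copies of L^2(Sigma) that induce the
   product topology are equivalent; the sum of the norms is used. *)
Definition bounded_op := exists c : R, forall theta : Theta,
  `|Z theta| <= c * \sum_e fine (Lq_norm Sigma 2 (theta e)).

Definition residual (m : measures) (theta : Theta) (l : 'I_L) :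
    {ffun 'I_(width l.+1) -> dualC0 (layer l.+1)} :=
  m (inner l) -
    [ffun k => embed (layer l.+1) (@layer_conv m theta (outer l) k)].

Definition energy (m : measures) (theta : Theta) : \bar R :=
  (\sum_(l < L.+1) \sum_(n < width l.+1) (dual_norm (m l n))%:E +
   \sum_(l < L) J (residual m theta l))%E.

Definition feasible (v : 'rV[R]_d -> R) : set (measures * Theta) :=
  [set p | [/\ v = layer_conv p.1 p.2 (l := ord0) (ord0 : 'I_1) %[ae leb_on Omega],
     forall e, (Lq_norm Sigma 2 (p.2 e) <= 1)%E & Z p.2 = 0]].

(* ereal_inf set0 = +oo *)
Definition prior (v : 'rV[R]_d -> R) : \bar R :=
  ereal_inf [set energy p.1 p.2 | p in feasible v].

End network.

(* Main.v *)
Require Import Defs.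
From HB Require Import structures.
From mathcomp Require Import all_boot all_order all_algebra.
From mathcomp Require Import all_classical all_reals all_analysis.
From mathcomp Require Import measurable_realfun lra.
Set Implicit Arguments.
Unset Strict Implicit.
Unset Printing Implicit Defensive.
Import Order.TTheory GRing.Theory Num.Theory.
Import numFieldNormedType.Exports.
Import HBNNSimple.
Local Open Scope classical_set_scope.
Local Open Scope ring_scope.

(** Properness and coercivity of the generative prior.

    Coercivity. There is a constant C with |v|_q <= C * prior v for every v.
    Indeed, if (mu, theta) is feasible for v, then v is a finite sum of
    convolutions mu * theta of first-layer measures with functions of L2 norm at
    most 1. The inequality |mu * theta|_2 <= 2 |mu| |theta|_2
    (is_conv_Lnorm2_le), together with the inclusion of L2 in Lq over a set of
    finite measure (Lnorm_le_Lnorm2), bounds each term by a multiple of |mu|,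
    which is at most the energy (feasible_norm_le).

    The convolution inequality is obtained by duality in L2: the convolution is
    characterized by its integrals against functions of Cc(w), these are bounded
    by |mu| |theta|_2 |phi|_2 through Cauchy-Schwarz and the translation
    invariance of the Lebesgue measure (sqint_shift_le), and Cc(w) is large
    enough for such bounds to control the L2 norm (Lnorm2_le_dual_bound). The
    density of Cc(w) behind this (l2_closure_Cc) comes from bump functions that
    increase to the indicator of an open set, and from the pi-lambda theorem.

    Properness. With zero measures and zero weights all convolutions represent
    the zero measure, so that every residual vanishes and the energy is 0
    (prior_proper). *)

(** * Lebesgue measure: translations and bounded sets *)

Lemma ge0_integral_lebesgue_shift (R : realType) (a : R) (f : R -> \bar R) :
  measurable_fun [set: measurableTypeR R] f -> (forall x, 0 <= f x)%E ->
  (\int[lebesgue_measure]_x f (x + a)%R = \int[lebesgue_measure]_x f x)%E.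
Proof.
move=> mf f0.
pose T := measurableTypeR R; pose shift : T -> T := fun x => x + a.
have mshift : measurable_fun setT shift.
  by apply: measurable_funD => //; exact: measurable_cst.
pose mu := pushforward (@lebesgue_measure R) shift.
transitivity (\int[mu]_x f x)%E; first by rewrite ge0_integral_pushforward.
apply: eq_measure_integral => A mA _; apply/esym.
apply: (lebesgue_measure_unique (mu := [the measure _ _ of mu])) => // X [[u v] _ <-].
rewrite /mu /= /pushforward.
rewrite (_ : _ @^-1` _ = `]u - a, v - a]%classic).
  by rewrite !lebesgue_measure_itv /= !lte_fin ltrD2r -!EFinB opprD opprK addrACA addNr addr0.
by apply/seteqP; split=> x /=; rewrite !in_itv /= ltrBlDr lerBrDr.
Qed.

Lemma measurable_shift_rV (R : realType) d (y : 'rV[R]_d) :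
  measurable_fun [set: 'rV[R]_d] (fun x : 'rV[R]_d => x + y).
Proof.
apply: (@measurability _ _ _ _ _ _ (@open 'rV[R]_d)) => //.
move=> _ [U oU <-]; rewrite setTI; apply: (@open_measurable_rV R d).
move: U oU; apply/continuousP => v.
by apply: continuousD; [exact: cvg_id|exact: cst_continuous].
Qed.

(** Induction on the dimension: Tonelli's theorem peels off the first coordinate,
    and the translation acts separately on it and on the remaining ones. *)
Lemma ge0_integral_lebesgue_rV_shift (R : realType) d (y : 'rV[R]_d)
    (f : 'rV[R]_d -> \bar R) :
  measurable_fun setT f -> (forall x, 0 <= f x)%E ->
  (\int[lebesgue_rV d]_x f (x + y)%R = \int[lebesgue_rV d]_x f x)%E.
Proof.
elim: d y f => [|d IH] y f mf f0.
  by apply: eq_integral => x _; congr f; apply/rowP; case.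
have mcons := @measurable_rV_cons R d.
have mfy : measurable_fun setT (fun x : 'rV[R]_d.+1 => f (x + y)).
  by apply: measurableT_comp => //; exact: measurable_shift_rV.
rewrite [LHS](ge0_integral_pushforward mcons)//.
rewrite [RHS](ge0_integral_pushforward mcons)//.
rewrite !preimage_setT.
rewrite (fubini_tonelli1 ((fun x : 'rV[R]_d.+1 => f (x + y)) \o @rV_cons R d));
  [|exact: (measurableT_comp _ mcons)|by move=> ?; exact: f0].
rewrite (fubini_tonelli1 (f \o @rV_cons R d));
  [|exact: (measurableT_comp _ mcons)|by move=> ?; exact: f0].
rewrite /fubini_F.
pose F x := (\int[lebesgue_rV d]_z f (rV_cons (x, z)))%E.
transitivity (\int[lebesgue_measure]_x F (x + y 0 0)%R)%E; last first.
  rewrite ge0_integral_lebesgue_shift//; last by move=> x; exact: integral_ge0.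
  exact: (measurable_fun_fubini_tonelli_F (f \o @rV_cons R d)
    (measurableT_comp mf mcons) (fun=> f0 _)).
apply: eq_integral => x _ /=.
rewrite /F -(IH (\row_j y 0 (lift 0 j)))//; last first.
  by apply: measurableT_comp => //; apply: measurableT_comp => //; exact: pair1_measurable.
apply: eq_integral => z _; congr f; apply/rowP => j.
by rewrite !mxE; case: unliftP => [k ->|->] /=; rewrite ?mxE.
Qed.

(** A bounded set lies in a cube, whose measure is known. *)
Lemma lebesgue_rV_bounded (R : realType) d (A : set 'rV[R]_d) :
  measurable A -> bounded_set A -> (lebesgue_rV d A < +oo)%E.
Proof.
move=> mA [M [_ /(_ (`|M| + 1))]]; rewrite (le_lt_trans (ler_norm M)) ?ltrDl// => /(_ isT) AM.
(* the boxes of known measure are half open, hence the second + 1 *)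
pose b := `|M| + 1 + 1.
have b0 : 0 <= b by rewrite !addr_ge0.
have bb : - b <= b by lra.
have [mB lB] := @lebesgue_rV_box R d (fun=> - b) (fun=> b) (fun=> bb).
apply: le_lt_trans (ltry (\prod_(i < d) (b - - b))).
rewrite -lB; apply: le_measure; rewrite ?inE// => v /AM vM i.
have : `|v 0 i| <= `|M| + 1.
  apply: le_trans vM; rewrite [leRHS]/Num.norm /= mx_normrE.
  by apply/bigmax_geP; right => /=; exists (0, i).
by rewrite ler_norml => /andP[h1 h2]; rewrite /b; apply/andP; split; lra.
Qed.

(** * Square integrals and the L2 norm *)

(** The square of the L2 norm rather than the norm itself: it is a plain integral
    of a nonnegative function, so that monotonicity, additivity and monotone
    convergence apply without roots. *)
Definition sqint dT (T : measurableType dT) (R : realType)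
    (mu : {measure set T -> \bar R}) (f : T -> R) : \bar R :=
  (\int[mu]_x (f x ^+ 2)%:E)%E.

Arguments sqint {dT T R} mu f%_ring_scope.

Lemma measurable_sqr dT (T : measurableType dT) (R : realType) (f : T -> R) :
  measurable_fun setT f -> measurable_fun setT (fun x => (f x ^+ 2)%:E).
Proof. by move=> mf; apply/measurable_EFinP; exact: measurable_funX. Qed.

Lemma sqint_ge0 dT (T : measurableType dT) (R : realType)
    (mu : {measure set T -> \bar R}) (f : T -> R) : (0 <= sqint mu f)%E.
Proof. by apply: integral_ge0 => x _; rewrite lee_fin sqr_ge0. Qed.

Lemma Lnorm2E dT (T : measurableType dT) (R : realType)
    (mu : {measure set T -> \bar R}) (f : T -> R) :
  ('N[mu]_2%:E[EFin \o f] = sqrte (sqint mu f))%E.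
Proof.
rewrite unlock /Lnorm poweR12_sqrt; last by apply: integral_ge0 => x _; exact: poweR_ge0.
congr sqrte; apply: eq_integral => x _ /=.
by rewrite powR_mulrn// real_normK// num_real.
Qed.

Lemma Lnorm2_le dT (T : measurableType dT) (R : realType)
    (mu : {measure set T -> \bar R}) (f : T -> R) (c : R) : 0 <= c ->
  ('N[mu]_2%:E[EFin \o f] <= c%:E)%E = (sqint mu f <= (c ^+ 2)%:E)%E.
Proof.
move=> c0; have -> : c%:E = sqrte (c ^+ 2)%:E by rewrite /= sqrtr_sqr ger0_norm.
by rewrite Lnorm2E lee_sqrt// lee_fin sqr_ge0.
Qed.

Lemma Lfun2P dT (T : measurableType dT) (R : realType)
    (mu : {measure set T -> \bar R}) (f : T -> R) :
  measurable_fun setT f -> (sqint mu f < +oo)%E -> f \in Lfun mu 2%:E.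
Proof.
move=> mf f2; rewrite inE; apply/andP; split; rewrite inE//=.
rewrite /finite_norm Lnorm2E; move: f2; have := sqint_ge0 mu f.
by case: sqint => //= r _ _; rewrite ltry.
Qed.

Lemma Lfun2_sqint_lty dT (T : measurableType dT) (R : realType)
    (mu : {measure set T -> \bar R}) (f : T -> R) :
  f \in Lfun mu 2%:E -> (sqint mu f < +oo)%E.
Proof.
rewrite inE => /andP[_]; rewrite inE /= /finite_norm Lnorm2E.
by have := sqint_ge0 mu f; case: sqint => //= r _ _; rewrite ltry.
Qed.
Lemma Lfun_measurable dT (T : measurableType dT) (R : realType)
    (mu : {measure set T -> \bar R}) p (f : T -> R) :
  f \in Lfun mu p -> measurable_fun setT f.
Proof. by rewrite inE => /andP[]; rewrite inE. Qed.

Lemma Lfun_fin dT (T : measurableType dT) (R : realType)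
    (mu : {measure set T -> \bar R}) p (f : T -> R) :
  f \in Lfun mu p -> ('N[mu]_p[EFin \o f])%E \is a fin_num.
Proof.
by rewrite inE => /andP[_]; rewrite inE /= /finite_norm => h; rewrite ge0_fin_numE// Lnorm_ge0.
Qed.

Lemma cauchy_schwarz dT (T : measurableType dT) (R : realType)
    (mu : {measure set T -> \bar R}) (f g : T -> R) :
  f \in Lfun mu 2%:E -> g \in Lfun mu 2%:E ->
  `|\int[mu]_x (f x * g x)| <=
    fine ('N[mu]_2%:E[EFin \o f])%E * fine ('N[mu]_2%:E[EFin \o g])%E.
Proof.
move=> Lf Lg.
have /Lfun1_integrable fgi := Lfun2_mul_Lfun1 Lf Lg.
apply: (le_trans (le_normr_Rintegral measurableT fgi)).
have foo : (\int[mu]_x `|(f x * g x)%:E|)%E \is a fin_num.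
  have /integrableP[_ h] := fgi; rewrite ge0_fin_numE//.
  exact: integral_ge0.
rewrite -fineM ?Lfun_fin// fine_le ?fin_numM ?Lfun_fin//.
have h2 : 2^-1 + 2^-1 = 1 :> R by lra.
have := hoelder mu (Lfun_measurable Lf) (Lfun_measurable Lg) (ltr0n _ 2) (ltr0n _ 2) h2.
by rewrite Lnorm1.
Qed.

(** A substitute for the triangle inequality that stays within squares. *)
Lemma sqintD_le dT (T : measurableType dT) (R : realType)
    (mu : {measure set T -> \bar R}) (f g : T -> R) :
  measurable_fun setT f -> measurable_fun setT g ->
  (sqint mu (f \+ g) <= 2%:E * sqint mu f + 2%:E * sqint mu g)%E.
Proof.
move=> mf mg; rewrite /sqint.
have sq0 (h : T -> R) x : (0 <= (h x ^+ 2)%:E)%E by rewrite lee_fin sqr_ge0.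
have [mf2 mg2] := (measurable_sqr mf, measurable_sqr mg).
rewrite -!ge0_integralZl_EFin// -ge0_integralD//; last 4 first.
- by move=> x _; rewrite -EFinM lee_fin mulr_ge0// sqr_ge0.
- exact: measurable_funeM.
- by move=> x _; rewrite -EFinM lee_fin mulr_ge0// sqr_ge0.
- exact: measurable_funeM.
apply: ge0_le_integral => //.
- by apply: measurable_sqr; exact: measurable_funD.
- by apply: emeasurable_funD; exact: measurable_funeM.
move=> x _; rewrite -!EFinM -EFinD lee_fin /=.
have := sqr_ge0 (f x - g x); nra.
Qed.

(** * Closure of a linear space of functions in L2 *)
Definition l2_closure dT (T : measurableType dT) (R : realType)
    (mu : {measure set T -> \bar R}) (S : set (T -> R)) : set (T -> R) :=
  [set h : T -> R | measurable_fun setT h /\ forall e, 0 < e ->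
     exists2 phi, S phi & (sqint mu (h \- phi) <= e%:E)%E].

Lemma sub_l2_closure dT (T : measurableType dT) (R : realType)
    (mu : {measure set T -> \bar R}) (S : set (T -> R)) :
  (forall f, S f -> measurable_fun setT f) -> S `<=` l2_closure mu S.
Proof.
move=> Sm f Sf; split=> [|e e0]; first exact: Sm.
exists f => //; rewrite (_ : sqint _ _ = 0%E) ?lee_fin ?ltW//.
by apply: integral0_eq => x _ /=; rewrite subrr expr0n.
Qed.

Lemma l2_closure_closed dT (T : measurableType dT) (R : realType)
    (mu : {measure set T -> \bar R}) (S : set (T -> R)) (h : T -> R) :
  (forall f, S f -> measurable_fun setT f) -> measurable_fun setT h ->
  (forall e, 0 < e -> exists2 k, l2_closure mu S k & (sqint mu (h \- k) <= e%:E)%E) ->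
  l2_closure mu S h.
Proof.
move=> Sm mh hS; split=> // e e0; have e4 : 0 < e / 4 by rewrite divr_gt0.
have [k [mk /(_ _ e4)[phi Sphi kphi]] hk] := hS _ e4; exists phi => //.
have := sqintD_le mu (measurable_funB mh mk) (measurable_funB mk (Sm _ Sphi)).
rewrite (_ : _ \+ _ = h \- phi); last by apply/funext => x /=; lra.
move=> /le_trans; apply.
rewrite (_ : e%:E = 2%:E * (e / 4)%:E + 2%:E * (e / 4)%:E)%E; last first.
  by rewrite -!EFinM -EFinD; congr EFin; lra.
by apply: leeD; rewrite lee_pmul2l.
Qed.

(** The two approximation errors are e / (4 (a^2 + 1)) and e / 4, so that
    2 a^2 e / (4 (a^2 + 1)) + 2 e / 4 <= e in the bound of sqintD_le. *)
Lemma l2_closure_linear dT (T : measurableType dT) (R : realType)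
    (mu : {measure set T -> \bar R}) (S : set (T -> R)) (a : R) (h k : T -> R) :
  (forall f, S f -> measurable_fun setT f) ->
  (forall (a : R) f g, S f -> S g -> S (a \*o f \+ g)) ->
  l2_closure mu S h -> l2_closure mu S k -> l2_closure mu S (a \*o h \+ k).
Proof.
move=> Sm SD [mh hS] [mk kS]; split.
  by apply: measurable_funD => //; exact: measurable_funM.
move=> e e0; pose b := a ^+ 2 + 1; have b0 : 0 < b by rewrite ltr_wpDl// sqr_ge0.
have e1 : 0 < e / (4 * b) by rewrite divr_gt0// mulr_gt0.
have e2 : 0 < e / 4 by rewrite divr_gt0.
have [phi Sphi hphi] := hS _ e1; have [psi Spsi kpsi] := kS _ e2.
exists (a \*o phi \+ psi); first exact: SD.
have mhp := measurable_funB mh (Sm _ Sphi).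
have mahp : measurable_fun setT (a \*o (h \- phi)) by exact: measurable_funM.
have := sqintD_le mu mahp (measurable_funB mk (Sm _ Spsi)).
rewrite (_ : _ \+ _ = (a \*o h \+ k) \- (a \*o phi \+ psi)); last first.
  by apply/funext => x /=; lra.
move=> /le_trans; apply.
rewrite (_ : sqint mu (a \*o _) = (a ^+ 2)%:E * sqint mu (h \- phi))%E; last first.
  rewrite /sqint -ge0_integralZl_EFin ?sqr_ge0//; last 2 first.
  - by move=> x _; rewrite lee_fin sqr_ge0.
  - exact: measurable_sqr.
  by apply: eq_integral => x _; rewrite -EFinM /= exprMn.
rewrite (_ : e%:E = 2%:E * (b%:E * (e / (4 * b))%:E) + 2%:E * (e / 4)%:E)%E; last first.
  rewrite -!EFinM -EFinD; congr EFin; rewrite invfM (mulrCA b) (mulrCA b) mulfV ?gt_eqF//.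
  by rewrite mulr1; lra.
apply: leeD; rewrite lee_pmul2l//; apply: lee_pmul => //.
- by rewrite lee_fin sqr_ge0.
- exact: sqint_ge0.
- by rewrite lee_fin lerDl.
Qed.

(** Continuity from above along the decreasing differences, which is where
    the finiteness of mu enters. *)
Lemma small_tail dT (T : measurableType dT) (R : realType)
    (mu : {measure set T -> \bar R}) (F : nat -> set T) (e : R) :
  (mu setT < +oo)%E -> (forall n, measurable (F n)) ->
  {homo F : n m / (n <= m)%N >-> (n <= m)%O} -> 0 < e ->
  exists n, (mu ((\bigcup_n F n) `\` F n) <= e%:E)%E.
Proof.
move=> muT mF ndF e0; pose A := \bigcup_n F n.
have mA : measurable A by exact: bigcup_measurable.
have mD n : measurable (A `\` F n) by exact: measurableD.
have D0 : \bigcap_n (A `\` F n) = set0.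
  by apply/seteqP; split => // x h; have [[n _ Fn] _] := h 0%N I; have [] := h n I.
have mD0 : (mu \o (fun n => A `\` F n)) n @[n --> \oo] --> 0%E.
  rewrite -[0%E](measure0 mu) -D0; apply: nonincreasing_cvg_mu => //.
  - by apply: le_lt_trans muT; apply: le_measure; rewrite ?inE.
  - by rewrite D0.
  by move=> n m nm; apply/subsetPset; apply: setDS; exact/subsetPset/ndF.
have [|n _ /(_ n (leqnn n)) /= /ltW] := mD0 [set y | (y < e%:E)%E].
  by apply: open_nbhs_nbhs; split; [exact: open_ereal_lt_ereal|rewrite /= lte_fin].
by exists n.
Qed.

(** The form in which bump functions approximate indicators: the error is at
    most 1 and confined to the shell between B and A. *)
Lemma sqint_indicB dT (T : measurableType dT) (R : realType)
    (mu : {measure set T -> \bar R}) (A B : set T) (phi : T -> R) :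
  measurable A -> measurable B -> measurable_fun setT phi ->
  (forall x, B x -> phi x = 1) -> (forall x, ~ A x -> phi x = 0) ->
  (forall x, 0 <= phi x <= 1) ->
  (sqint mu (\1_A \- phi) <= mu (A `\` B))%E.
Proof.
move=> mA mB mphi phiB phiA phi01.
have mAB : measurable (A `\` B) by exact: measurableD.
rewrite -[A `\` B]setIT -integral_indic//; apply: ge0_le_integral => //.
- by move=> x _; rewrite lee_fin sqr_ge0.
- by apply: measurable_sqr; exact: measurable_funB.
- exact/measurable_EFinP.
move=> x _; rewrite lee_fin /= !indicE.
have [Bx|Bx] := pselect (B x).
  rewrite [x \in A `\` B]memNset; last by case.
  rewrite phiB// mem_set ?subrr ?expr0n//.
  by apply: contrapT => /phiA; rewrite phiB// => /eqP; rewrite oner_eq0.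
have [Ax|Ax] := pselect (A x).
  rewrite mem_set// mem_set//=.
  by have /andP[p0 p1] := phi01 x; rewrite expr_le1 ?subr_ge0// lerBlDr lerDl.
by rewrite memNset// phiA// subrr expr0n.
Qed.

(** The sets whose indicator lies in the closure form a lambda-system, so the
    pi-lambda theorem extends the property from G to the generated
    sigma-algebra. *)
Lemma l2_closure_sigma dT (T : measurableType dT) (R : realType)
    (mu : {measure set T -> \bar R}) (S : set (T -> R)) (G : set (set T)) :
  (forall f, S f -> measurable_fun setT f) ->
  (forall (a : R) f g, S f -> S g -> S (a \*o f \+ g)) ->
  (mu setT < +oo)%E ->
  setI_closed G -> G setT -> (forall A, G A -> measurable A) ->
  (forall A, G A -> l2_closure mu S \1_A) ->
  forall A, <<s G >> A -> l2_closure mu S \1_A.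
Proof.
move=> Sm SD muT GI GT Gm GS A sA.
pose H := [set A : set T | measurable A /\ l2_closure mu S \1_A].
suff /(_ _ sA)[] : <<s G >> `<=` H by [].
apply: lambda_system_subset => //; last by move=> X GX; split; [exact: Gm|exact: GS].
split => //.
- by split; [exact: measurableT|exact: GS].
- move=> X Y YX [mX SX] [mY SY]; split; first exact: measurableD.
  rewrite (_ : \1_(X `\` Y) = (-1) \*o \1_Y \+ \1_X :> (T -> R)).
    exact: l2_closure_linear.
  apply/funext => x /=; rewrite !indicE.
  have [Yx|Yx] := pselect (Y x).
    by rewrite memNset ?mem_set//=; [rewrite mulr1 addNr|exact: YX|case].
  rewrite [x \in Y]memNset//= mulr0 add0r; congr (nat_of_bool _)%:R.
  by apply/idP/idP; rewrite !inE => // -[].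
- move=> F ndF FH; have mF n : measurable (F n) by have [] := FH n.
  have mU : measurable (\bigcup_i F i) by exact: bigcup_measurable.
  split=> //; apply: l2_closure_closed => // e e0.
  have [n Fe] := small_tail muT mF ndF e0.
  exists \1_(F n); first by have [] := FH n.
  apply: le_trans Fe; apply: sqint_indicB => //.
  + by move=> x Fx; rewrite indicE mem_set.
  + by move=> x Ux; rewrite indicE memNset// => Fx; apply: Ux; exists n.
  + by move=> x; rewrite indicE; case: (_ \in _); rewrite ?lexx ?ler01.
Qed.

Lemma l2_closure_simple dT (T : measurableType dT) (R : realType)
    (mu : {measure set T -> \bar R}) (S : set (T -> R)) :
  (forall f, S f -> measurable_fun setT f) -> S (cst 0) ->
  (forall (a : R) f g, S f -> S g -> S (a \*o f \+ g)) ->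
  (forall A, measurable A -> l2_closure mu S \1_A) ->
  forall h : {nnsfun T >-> R}, l2_closure mu S h.
Proof.
move=> Sm S0 SD SA h.
rewrite (_ : (h : T -> R) = fun x =>
    \sum_(y <- finmap.enum_fset (fset_set (range h))) y * \1_(h @^-1` [set y]) x); last first.
  by apply/funext => x; rewrite fimfunE fsbig_finite.
elim: (finmap.enum_fset _) => [|y s IH].
  rewrite (_ : (fun x => _) = cst 0); first exact: sub_l2_closure.
  by apply/funext => x; rewrite big_nil.
rewrite (_ : (fun x => _) = y \*o \1_(h @^-1` [set y]) \+
    (fun x => \sum_(y <- s) y * \1_(h @^-1` [set y]) x)); last first.
  by apply/funext => x; rewrite big_cons.
by apply: l2_closure_linear => //; exact: SA.
Qed.

(** * Norm bounds by duality *)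

(** The pairing with f is continuous for the L2 norm (Cauchy-Schwarz), so a
    bound on S passes to the limit. *)
Lemma dual_bound_l2_closure dT (T : measurableType dT) (R : realType)
    (mu : {measure set T -> \bar R}) (S : set (T -> R)) (f : T -> R) (c : R) :
  (forall g, S g -> g \in Lfun mu 2%:E) -> f \in Lfun mu 2%:E -> 0 <= c ->
  (forall g, S g -> `|\int[mu]_x (f x * g x)| <= c * fine ('N[mu]_2%:E[EFin \o g])%E) ->
  forall h, l2_closure mu S h -> h \in Lfun mu 2%:E ->
    `|\int[mu]_x (f x * h x)| <= c * fine ('N[mu]_2%:E[EFin \o h])%E.
Proof.
move=> S2 Lf c0 fS h [mh hS] Lh; set nh := fine _.
set nf := fine ('N[mu]_2%:E[EFin \o f])%E.
have nf0 : 0 <= nf by rewrite fine_ge0// Lnorm_ge0.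
apply/ler_addgt0Pr => e e0.
pose b := nf + c + 1; have b0 : 0 < b by rewrite ltr_wpDl// addr_ge0.
have eb0 : 0 < e / b by rewrite divr_gt0.
have [g Sg hg] := hS _ (exprn_gt0 2 eb0); have Lg := S2 _ Sg.
have mg := Lfun_measurable Lg.
have Lhg : h \- g \in Lfun mu 2%:E.
  by apply: Lfun2P; [exact: measurable_funB|exact: le_lt_trans hg (ltry _)].
move: hg; rewrite -(Lnorm2_le _ _ (ltW eb0)) => hg.
have {}hg : fine ('N[mu]_2%:E[EFin \o (h \- g)%R])%E <= e / b.
  by rewrite -lee_fin fineK// Lfun_fin.
have gh : fine ('N[mu]_2%:E[EFin \o g])%E <= nh + e / b.
  rewrite -lee_fin fineK ?Lfun_fin// [leRHS]EFinD /nh fineK ?Lfun_fin//.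
  have mgh := measurable_funB mg mh.
  have := @eminkowski _ _ _ mu h (g \- h) 2%:E mh mgh (lee1n 2).
  rewrite (_ : h \+ (g \- h) = g); last by apply/funext => x /=; lra.
  move=> /le_trans; apply; rewrite leeD2l//.
  rewrite -(oppe_Lnorm mu (EFin \o (g \- h)%R)).
  rewrite (_ : \- _ = EFin \o (h \- g)%R)%E; last first.
    by apply/funext => x /=; rewrite opprB.
  by rewrite -lee_fin fineK ?Lfun_fin// in hg.
have -> : \int[mu]_x (f x * h x) = \int[mu]_x (f x * g x) + \int[mu]_x (f x * (h \- g) x).
  rewrite -RintegralD//.
  - by apply: eq_Rintegral => x _ /=; lra.
  - by have /Lfun1_integrable := Lfun2_mul_Lfun1 Lf Lg.
  - by have /Lfun1_integrable := Lfun2_mul_Lfun1 Lf Lhg.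
apply: (le_trans (ler_normD _ _)).
apply: (@le_trans _ _ (c * (nh + e / b) + nf * (e / b))).
  apply: lerD; first by apply: (le_trans (fS _ Sg)); rewrite ler_wpM2l.
  by apply: (le_trans (cauchy_schwarz Lf Lhg)); rewrite ler_wpM2l.
rewrite mulrDr -addrA lerD2l -mulrDl mulrCA ger_pMr// ler_pdivrMr// mul1r /b.
by rewrite addrC lerDl.
Qed.

(** Test f against nonnegative simple functions h increasing to its positive
    part. They vanish where f <= 0, so h^2 <= f h everywhere and
    |h|^2 <= int f h <= c |h|, that is |h| <= c; let h increase. *)
Lemma sqint_pos_part_le_dual_bound dT (T : measurableType dT) (R : realType)
    (mu : {measure set T -> \bar R}) (S : set (T -> R)) (f : T -> R) (c : R) :
  (mu setT < +oo)%E ->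
  (forall g, S g -> g \in Lfun mu 2%:E) -> S (cst 0) ->
  (forall (a : R) f g, S f -> S g -> S (a \*o f \+ g)) ->
  (forall A, measurable A -> l2_closure mu S \1_A) ->
  f \in Lfun mu 2%:E -> 0 <= c ->
  (forall g, S g -> `|\int[mu]_x (f x * g x)| <= c * fine ('N[mu]_2%:E[EFin \o g])%E) ->
  (sqint mu (fun x => Num.max (f x) 0%R) <= (c ^+ 2)%:E)%E.
Proof.
move=> muT S2 S0 SD SA Lf c0 fS.
have Sm g : S g -> measurable_fun setT g by move=> /S2 /Lfun_measurable.
have mf := Lfun_measurable Lf.
pose fp x := Num.max (f x) 0.
have mfp : measurable_fun setT (EFin \o fp).
  by apply/measurable_EFinP; exact: measurable_maxr.
have fp0 x : setT x -> (0 <= (EFin \o fp) x)%E by move=> _; rewrite lee_fin le_max lexx orbT.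
pose h := nnsfun_approx measurableT mfp.
have ndh x : {homo (fun n => h n x) : n m / (n <= m)%N >-> (n <= m)%R}.
  by move=> n m /(nd_nnsfun_approx measurableT mfp) /lefP.
have cvh x : (h n x)%:E @[n --> \oo] --> (fp x)%:E.
  exact: (cvg_nnsfun_approx measurableT mfp fp0).
have hfp n x : h n x <= fp x.
  rewrite -lee_fin -(cvg_lim (@ereal_hausdorff R) (cvh x)); apply: lime_ge.
    by apply/cvg_ex; eexists; exact: cvh.
  by exists n => // k /= nk; rewrite lee_fin; exact: ndh.
have f2 := Lfun2_sqint_lty Lf.
have hle n : (sqint mu (h n) <= (c ^+ 2)%:E)%E.
  have mh : measurable_fun setT (h n) by exact: measurable_funP.
  have hf x : h n x ^+ 2 <= f x * h n x.
    rewrite expr2; have h0 : 0 <= h n x by [].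
    have := hfp n x; rewrite /fp; case: (leP (f x) 0) => fx hx; last by rewrite ler_wpM2r.
    by rewrite (_ : h n x = 0) ?mulr0//; apply/eqP; rewrite eq_le hx.
  have Lh : (h n : T -> R) \in Lfun mu 2%:E.
    apply: Lfun2P => //; apply: le_lt_trans f2; apply: ge0_le_integral => //.
    - by move=> x _; rewrite lee_fin sqr_ge0.
    - exact: measurable_sqr.
    - exact: measurable_sqr.
    move=> x _; rewrite lee_fin; have := hf x; have := sqr_ge0 (f x - h n x).
    by rewrite sqrrB; lra.
  have /Lfun1_integrable fhi := Lfun2_mul_Lfun1 Lf Lh.
  have h2 : (sqint mu (h n) <= (\int[mu]_x (f x * h n x))%:E)%E.
    rewrite fineK ?integrable_fin_num//; apply: ge0_le_integral => //.
    - by move=> x _; rewrite lee_fin sqr_ge0.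
    - exact: measurable_sqr.
    - exact: measurable_int fhi.
    - by move=> x _; rewrite lee_fin.
  have hS := l2_closure_simple Sm S0 SD SA (h n).
  have := dual_bound_l2_closure S2 Lf c0 fS hS Lh.
  set N := fine _ => fhN.
  have N0 : 0 <= N by rewrite fine_ge0// Lnorm_ge0.
  have NE : N%:E = ('N[mu]_2%:E[EFin \o (h n : T -> R)])%E by rewrite fineK// Lfun_fin.
  rewrite -Lnorm2_le// -NE lee_fin; have [->//|N0'] := eqVneq N 0.
  have {}N0 : 0 < N by rewrite lt_neqAle eq_sym N0'.
  rewrite -(ler_pM2r N0) -expr2; apply: le_trans fhN; apply: le_trans (ler_norm _).
  rewrite -lee_fin; apply: le_trans h2; rewrite EFin_expe NE Lnorm2E sqr_sqrte// sqint_ge0//.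
have cvh2 x : ((h n x) ^+ 2)%:E @[n --> \oo] --> (fp x ^+ 2)%:E.
  by rewrite EFin_expe; under eq_fun do rewrite EFin_expe; apply: cvgeM.
have mh2 n : measurable_fun setT (fun x => (h n x ^+ 2)%:E).
  by apply: measurable_sqr; exact: measurable_funP.
have -> : sqint mu fp = (\int[mu]_x limn (fun n => (h n x ^+ 2)%:E))%E.
  by apply: eq_integral => x _; exact/esym/cvg_lim.
rewrite monotone_convergence//; last 2 first.
- by move=> n x _; rewrite lee_fin sqr_ge0.
- by move=> x _ n m nm; rewrite lee_fin ler_pXn2r ?nnegrE//; exact: ndh.
apply: lime_le; last exact: nearW.
apply: ereal_nondecreasing_is_cvgn => n m nm; apply: ge0_le_integral => //.
- by move=> x _; rewrite lee_fin sqr_ge0.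
- by move=> x _; rewrite lee_fin ler_pXn2r ?nnegrE//; exact: ndh.
Qed.

(** Converse of Cauchy-Schwarz against a dense space of test functions. The
    constant is not sharp: the positive and negative parts are bounded by c
    separately, which gives sqrt 2 * c, rounded up to 2 c. *)
Lemma Lnorm2_le_dual_bound dT (T : measurableType dT) (R : realType)
    (mu : {measure set T -> \bar R}) (S : set (T -> R)) (f : T -> R) (c : R) :
  (mu setT < +oo)%E ->
  (forall g, S g -> g \in Lfun mu 2%:E) -> S (cst 0) ->
  (forall (a : R) f g, S f -> S g -> S (a \*o f \+ g)) ->
  (forall A, measurable A -> l2_closure mu S \1_A) ->
  f \in Lfun mu 2%:E -> 0 <= c ->
  (forall g, S g -> `|\int[mu]_x (f x * g x)| <= c * fine ('N[mu]_2%:E[EFin \o g])%E) ->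
  ('N[mu]_2%:E[EFin \o f] <= (2 * c)%:E)%E.
Proof.
move=> muT S2 S0 SD SA Lf c0 fS; have mf := Lfun_measurable Lf.
have Lnf : \- f \in Lfun mu 2%:E.
  have f2 := Lfun2_sqint_lty Lf.
  apply: Lfun2P; first exact: measurable_funN.
  by rewrite (_ : sqint _ _ = sqint mu f)//; apply: eq_integral => x _; rewrite /= sqrrN.
have fp := sqint_pos_part_le_dual_bound muT S2 S0 SD SA Lf c0 fS.
have /(sqint_pos_part_le_dual_bound muT S2 S0 SD SA Lnf c0) fn : forall g, S g ->
    `|\int[mu]_x ((\- f) x * g x)| <= c * fine ('N[mu]_2%:E[EFin \o g])%E.
  move=> g Sg; have /Lfun1_integrable fgi := Lfun2_mul_Lfun1 Lf (S2 _ Sg).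
  rewrite (_ : \int[mu]_x _ = - \int[mu]_x (f x * g x)); first by rewrite normrN fS.
  rewrite -[RHS]mulN1r -RintegralZl//.
  by apply: eq_Rintegral => x _ /=; rewrite mulN1r mulNr.
rewrite Lnorm2_le ?mulr_ge0//.
have mp (u : T -> R) : measurable_fun setT u ->
    measurable_fun setT (fun x => (Num.max (u x) 0 ^+ 2)%:E).
  by move=> mu'; apply: measurable_sqr; exact: measurable_maxr.
rewrite (_ : sqint mu f = sqint mu (fun x => Num.max (f x) 0%R) +
    sqint mu (fun x => Num.max ((\- f)%R x) 0%R))%E; last first.
  rewrite /sqint -ge0_integralD//.
  - apply: eq_integral => x _; rewrite -EFinD; congr EFin => /=.
    case: (leP (f x) 0) => fx; first by rewrite max_l ?oppr_ge0// sqrrN expr0n add0r.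
    by rewrite max_r ?oppr_le0 ?ltW// expr0n addr0.
  - by move=> x _; rewrite lee_fin sqr_ge0.
  - exact: mp.
  - by move=> x _; rewrite lee_fin sqr_ge0.
  - by apply: mp; exact: measurable_funN.
apply: (le_trans (leeD fp fn)); rewrite -EFinD lee_fin exprMn.
have := sqr_ge0 c; lra.
Qed.

Lemma bounded_Lfun2 dT (T : measurableType dT) (R : realType)
    (mu : {measure set T -> \bar R}) (f : T -> R) (c : R) :
  (mu setT < +oo)%E -> measurable_fun setT f -> (forall x, `|f x| <= c) ->
  f \in Lfun mu 2%:E.
Proof.
move=> muT mf fc; apply: Lfun2P => //.
apply: (@le_lt_trans _ _ (\int[mu]_x (c ^+ 2)%:E)%E).
  apply: ge0_le_integral => //.
  - by move=> x _; rewrite lee_fin sqr_ge0.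
  - exact: measurable_sqr.
  - move=> x _; rewrite lee_fin -(real_normK (num_real (f x))).
    by rewrite ler_pXn2r// nnegrE// (le_trans _ (fc x)).
by rewrite integral_cst//= lte_mul_pinfty// ?lee_fin ?sqr_ge0.
Qed.

(** * Integrals over an open set *)

Section leb_on.
Context (R : realType) (d : nat).
Implicit Types w : openSet R d.

Lemma leb_on_finite w : bounded_set (w : set 'rV[R]_d) -> (leb_on w setT < +oo)%E.
Proof.
move=> bw; rewrite /= /mrestr setTI; apply: lebesgue_rV_bounded => //.
by apply: open_measurable_rV; exact: openP.
Qed.

Lemma ge0_integral_leb_on_le w (f : 'rV[R]_d -> \bar R) :
  measurable_fun setT f -> (forall x, 0 <= f x)%E ->
  (\int[leb_on w]_x f x <= \int[lebesgue_rV d]_x f x)%E.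
Proof.
move=> mf f0; apply: ge0_le_measure_integral => // A mA.
rewrite /= /mrestr; apply: le_measure; rewrite ?inE//.
by apply: measurableI => //; apply: open_measurable_rV; exact: openP.
Qed.

(** The Lebesgue measure is the sum of its restrictions to w and to the
    complement of w, and f is almost everywhere 0 for the latter. *)
Lemma ge0_integral_leb_on w (f : 'rV[R]_d -> \bar R) :
  measurable_fun setT f -> (forall x, 0 <= f x)%E ->
  (forall x, ~ open_carrier w x -> f x = 0%E) ->
  (\int[lebesgue_rV d]_x f x = \int[leb_on w]_x f x)%E.
Proof.
move=> mf f0 fw; have mw : measurable (w : set 'rV[R]_d).
  by apply: open_measurable_rV; exact: openP.
pose nu := mrestr (lebesgue_rV d) (measurableC mw).
rewrite (@eq_measure_integral _ _ _ _ (measure_add (leb_on w) nu)); last first.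
  move=> A mA _; apply: etrans; last exact/esym/measure_addE.
  rewrite /= /mrestr /nu /mrestr.
  by rewrite -measureU//; [rewrite -setIUr setUv setIT|exact: measurableI|
    apply: measurableI => //; exact: measurableC|rewrite setIACA setICr setI0].
rewrite ge0_integral_measure_add// [X in (_ + X)%E](_ : _ = 0%E) ?adde0//.
rewrite -(integral0 nu setT); apply: ae_eq_integral => //.
exists w; split => //; first by rewrite /nu /= /mrestr setICr measure0.
by move=> x /= h; apply: contrapT => /fw fx; apply: h.
Qed.

(** Extending the first integral to the whole space makes the translation
    harmless; as f vanishes off w, the whole space can then be cut down to w. *)
Lemma sqint_shift_le w v (f : 'rV[R]_d -> R) (y : 'rV[R]_d) :
  measurable_fun setT f -> (forall x, ~ open_carrier w x -> f x = 0) ->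
  (sqint (leb_on v) (fun x => f (x + y)%R) <= sqint (leb_on w) f)%E.
Proof.
move=> mf fw; have mf2 := measurable_sqr mf.
have f20 x : (0 <= (f x ^+ 2)%:E)%E by rewrite lee_fin sqr_ge0.
apply: (@le_trans _ _ (\int[lebesgue_rV d]_x (f (x + y)%R ^+ 2)%:E)%E).
  apply: ge0_integral_leb_on_le => //.
  by apply: (measurableT_comp mf2); exact: measurable_shift_rV.
rewrite (ge0_integral_lebesgue_rV_shift y mf2)// (@ge0_integral_leb_on w)// => x /fw ->.
by rewrite expr0n.
Qed.

End leb_on.

(** * Density of Cc(w) in L2(w) *)

Section bump.
Context (R : realType) (d : nat) (V : set 'rV[R]_d).

Definition trunc_dists (x : 'rV[R]_d) : set R :=
  [set r | r = 1 \/ exists2 y, ~ V y & r = `|x - y|].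

(** min(1, dist(x, ~` V)); the truncation makes the infimum meaningful also
    when V is the whole space, as happens in dimension 0. *)
Definition trunc_dist x : R := inf (trunc_dists x).

Lemma trunc_dists_ge0 x : lbound (trunc_dists x) 0.
Proof. by move=> r [->|[y _ ->]]. Qed.

Lemma has_inf_trunc_dists x : has_inf (trunc_dists x).
Proof. by split; [exists 1; left|exists 0; exact: trunc_dists_ge0]. Qed.

Lemma trunc_dist_le x y : trunc_dist x <= trunc_dist y + `|x - y|.
Proof.
rewrite -lerBlDr; apply: lb_le_inf; first by exists 1; left.
move=> r [->|[z Vz ->]]; rewrite lerBlDr.
  apply: (@le_trans _ _ 1); last by rewrite lerDl.
  by apply: ge_inf; [exact: (has_inf_trunc_dists x).2|left].
apply: (@le_trans _ _ `|x - z|).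
  by apply: ge_inf; [exact: (has_inf_trunc_dists x).2|right; exists z].
by rewrite [leRHS]addrC -(subrKA y x (- z)) ler_normD.
Qed.

Lemma trunc_dist_continuous : continuous trunc_dist.
Proof.
move=> x; apply/(@cvgrPdist_le _ _ _ (nbhs x) (nbhs_filter x)) => e e0.
apply/nbhs_ballP; exists e => //= y; rewrite -ball_normE /= => xy.
rewrite ler_norml; apply/andP; split.
  have := trunc_dist_le y x; rewrite distrC; move: xy; lra.
have := trunc_dist_le x y; move: xy; lra.
Qed.

Lemma trunc_dist0 x : ~ V x -> trunc_dist x = 0.
Proof.
move=> Vx; apply/eqP; rewrite eq_le; apply/andP; split; last first.
  by apply: lb_le_inf; [exists 1; left|exact: trunc_dists_ge0].
by apply: ge_inf; [exact: (has_inf_trunc_dists x).2|right; exists x => //; rewrite subrr normr0].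
Qed.

Lemma trunc_dist_gt0 x : open V -> V x -> 0 < trunc_dist x.
Proof.
move=> oV Vx; have /nbhs_ballP[e /= e0 eV] : nbhs x V by exact: open_nbhs_nbhs.
apply: (@lt_le_trans _ _ (Num.min 1 e)); first by rewrite lt_min ltr01.
apply: lb_le_inf; first by exists 1; left.
move=> r [->|[y Vy ->]]; rewrite ge_min ?lexx//; apply/orP; right.
rewrite leNgt; apply/negP => xy; apply: Vy; apply: eV.
by rewrite -ball_normE.
Qed.

(** With t the truncated distance, bump n is 1 where t >= 2 / (n + 2) and 0
    where t <= 1 / (n + 2). The gap between the two thresholds keeps the closed
    support inside V; the shift n + 2 makes both thresholds at most 1. *)
Definition bump n x := Num.max 0 (Num.min 1 (n.+2%:R * trunc_dist x - 1)).

Definition bump_core n := [set x | 2 <= n.+2%:R * trunc_dist x].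

Lemma bump_continuous n : continuous (bump n).
Proof.
move=> x; apply: (@continuous_max _ _ (cst 0)
  (fun y => Num.min 1 (n.+2%:R * trunc_dist y - 1)) x); first exact: cst_continuous.
apply: (@continuous_min _ _ (cst 1) (fun y => n.+2%:R * trunc_dist y - 1) x).
  exact: cst_continuous.
apply: (@continuousB R R^o _ (fun y => n.+2%:R * trunc_dist y) (cst 1) x).
  apply: (@continuousM R _ (cst n.+2%:R) trunc_dist x); first exact: cst_continuous.
  exact: trunc_dist_continuous.
exact: cst_continuous.
Qed.

Lemma bump_core1 n x : bump_core n x -> bump n x = 1.
Proof. by rewrite /bump_core/bump/= => h; rewrite min_l ?max_r//; lra. Qed.

Lemma bump_out n x : ~ V x -> bump n x = 0.
Proof. by move=> /trunc_dist0; rewrite /bump => ->; rewrite mulr0 min_r ?max_l//; lra. Qed.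

Lemma bump01 n x : 0 <= bump n x <= 1.
Proof. by rewrite /bump le_max lexx/= ge_max ler01/= ge_min lexx. Qed.

Lemma bump_core_nd : {homo bump_core : n m / (n <= m)%N >-> (n <= m)%O}.
Proof.
move=> n m nm; apply/subsetPset => x /= /le_trans; apply.
apply: ler_wpM2r; last by rewrite ler_nat.
by apply: lb_le_inf; [exists 1; left|exact: trunc_dists_ge0].
Qed.

Lemma bigcup_bump_core : open V -> \bigcup_n bump_core n = V.
Proof.
move=> oV; apply/seteqP; split=> x.
  move=> [n _ /=]; apply: contraPP => /trunc_dist0 x0.
  by rewrite /bump_core/= x0 mulr0; apply/negP; rewrite -ltNge.
move=> /(trunc_dist_gt0 oV) x0; exists (Num.truncn (2 / trunc_dist x)) => //=.
rewrite /bump_core/= -ler_pdivrMr//; apply: ltW.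
apply: (lt_le_trans (truncnS_gt _)); by rewrite ler_nat.
Qed.

Lemma measurable_bump_core n : measurable (bump_core n).
Proof.
have mt : measurable_fun setT trunc_dist.
  by apply: (@continuous_measurable_rV R d); exact: trunc_dist_continuous.
have -> : bump_core n = setT `&` trunc_dist @^-1` `[2 / n.+2%:R, +oo[%classic.
  rewrite setTI; apply/seteqP; split=> x /=; rewrite in_itv/= andbT.
    by rewrite ler_pdivrMr// mulrC.
  by rewrite ler_pdivrMr// mulrC.
by apply: mt.
Qed.

Lemma bump_Cc n (w : openSet R d) : V `<=` w -> bounded_set (w : set 'rV[R]_d) ->
  Cc w (bump n).
Proof.
move=> Vw bw; pose K := [set x | 1 <= n.+2%:R * trunc_dist x].
have KV : K `<=` V.
  move=> x; apply: contraPP => /trunc_dist0; rewrite /K/= => ->.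
  by rewrite mulr0; apply/negP; rewrite -ltNge.
have cK : closed K.
  have -> : K = trunc_dist @^-1` `[n.+2%:R^-1, +oo[%classic.
    apply/seteqP; split=> x; rewrite /K/= in_itv/= andbT -[_^-1]div1r;
    by rewrite ler_pdivrMr// mulrC.
  apply: (@preimage_closed _ _ trunc_dist); last exact: interval_closed.
  by move=> x _; exact: trunc_dist_continuous.
have sK : closure [set x | bump n x != 0] `<=` K.
  rewrite closureE => x; apply; split=> // y /=; rewrite /bump/K/=.
  apply: contra_neqT; rewrite -ltNge => h.
  by rewrite min_r ?max_l//; lra.
split.
- exact: bump_continuous.
- apply: bounded_closed_compact; last exact: closed_closure.
  case: bw => M [Mr wM]; exists M; split=> // r Mr' x /sK /KV /Vw; exact: wM.
- by move=> x /sK /KV /Vw.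
Qed.

End bump.

(** By l2_closure_sigma only open U are to be treated, and there the bumps of
    U `&` w approximate the indicator, w having finite measure. *)
Lemma l2_closure_Cc (R : realType) (d : nat) (w : openSet R d) :
  bounded_set (w : set 'rV[R]_d) ->
  forall A : set 'rV[R]_d, measurable A -> l2_closure (leb_on w) (Cc w) \1_A.
Proof.
move=> bw; have muT := leb_on_finite bw.
have [Cc0 CcD] := Cc_submod w.
have Ccm f : Cc w f -> measurable_fun setT f.
  by case=> cf _ _; exact: continuous_measurable_rV.
move=> A mA; apply: (@l2_closure_sigma _ _ _ (leb_on w) (Cc w) open) => //; clear A mA.
- by move=> A B; exact: openI.
- exact: openT.
- exact: open_measurable_rV.
move=> U oU; have mU : measurable U by exact: open_measurable_rV.
split=> [|e e0]; first exact: measurable_indic.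
pose V := U `&` w; have oV : open V by apply: openI => //; exact: openP.
have [n] := small_tail muT (measurable_bump_core V) (@bump_core_nd _ _ V) e0.
rewrite bigcup_bump_core// => Ve.
exists (bump V n); first by apply: bump_Cc => // x [].
have mb := measurable_bump_core V n.
apply: (@le_trans _ _ (leb_on w (U `\` bump_core V n))).
  apply: sqint_indicB => //.
  - by apply: (@continuous_measurable_rV R d); exact: bump_continuous.
  - by move=> x; exact: bump_core1.
  - by move=> x Ux; apply: bump_out => -[].
  - by move=> x; exact: bump01.
apply: le_trans Ve; rewrite /= /mrestr.
have mw : measurable (w : set 'rV[R]_d) by apply: open_measurable_rV; exact: openP.
have mV : measurable V by exact: measurableI.
apply: le_measure; rewrite ?inE.
- by apply: measurableI => //; exact: measurableD.
- by apply: measurableI => //; exact: measurableD.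
by move=> x [[Ux Bx] wx].
Qed.

(** * The dual of C_0(w) *)

Section dual.
Context (R : realType) (d : nat) (w : openSet R d).
Implicit Types m : dualC0 w.

Lemma dual_linear m (a : R) (f g : C0 w) : m (a *: f + g) = a * m f + m g.
Proof. by have := dualP m; rewrite inE => -[lm _]; exact: lm. Qed.

Lemma dual0 m : m 0 = 0.
Proof.
have := dual_linear m 1 0 0; rewrite scale1r addr0 mul1r => /eqP.
by rewrite -subr_eq0 opprD addrA subrr sub0r oppr_eq0 => /eqP.
Qed.

Lemma dual_norm_has_sup m :
  has_sup [set `|m phi| | phi in [set phi : C0 w | forall x, `|phi x| <= 1]].
Proof.
split.
  by exists `|m 0|, 0 => // x; rewrite normr0.
have := dualP m; rewrite inE => -[_ [c mc]]; exists c => _ [phi phi1 <-].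
exact: mc.
Qed.

Lemma dual_norm_ge0 m : 0 <= dual_norm m.
Proof.
apply: (@le_trans _ _ `|m 0|) => //; apply: ub_le_sup; first exact: (dual_norm_has_sup m).2.
by exists 0 => // x; rewrite normr0.
Qed.

Lemma dual_norm_bound m (phi : C0 w) (B : R) :
  (forall x, `|phi x| <= B) -> `|m phi| <= dual_norm m * B.
Proof.
move=> phiB; have : 0 <= B by exact: le_trans (phiB 0).
rewrite le_eqVlt => /orP[/eqP B0|B0].
  have -> : phi = 0.
    by apply/val_inj/funext => x; apply/eqP; rewrite -[eqbRHS]/(0 : R) -normr_le0 B0 phiB.
  by rewrite dual0 normr0 -B0 mulr0.
rewrite -ler_pdivrMr//.
have -> : `|m phi| / B = `|m (B^-1 *: phi + 0)|.
  by rewrite dual_linear dual0 addr0 normrM gtr0_norm ?invr_gt0// mulrC.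
apply: ub_le_sup; first exact: (dual_norm_has_sup m).2.
exists (B^-1 *: phi + 0) => // x.
rewrite addr0 -[X in `|X|]/(B^-1 * phi x) normrM gtr0_norm ?invr_gt0//.
by rewrite ler_pdivrMl// mulr1.
Qed.

(** Cc(w) is uniformly dense in C_0(w) and m is bounded. *)
Lemma dual_eq0 m :
  (forall phi : C0 w, Cc w phi -> m phi = 0) -> m = 0.
Proof.
move=> m0; apply/val_inj/funext => phi; rewrite -[RHS]/(0 : R).
apply/eqP; rewrite -normr_le0; apply/ler_addgt0Pr => e e0; rewrite add0r.
pose n := dual_norm m + 1; have n0 : 0 < n by rewrite ltr_wpDl// dual_norm_ge0.
have := C0P phi; rewrite inE => /(_ _ (divr_gt0 e0 n0))[psi cpsi phipsi].
have Cpsi : psi \in C0_pred w.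
  by rewrite inE => r r0; exists psi => // x; rewrite subrr normr0 ltW.
pose psi' : C0 w := MkC0 Cpsi.
have -> : val m phi = m ((-1) *: psi' + phi).
  by rewrite dual_linear (m0 psi' cpsi) mulr0 add0r.
apply: (le_trans (@dual_norm_bound m _ (e / n) _)).
  by move=> x; rewrite -[X in `|X|]/(-1 * psi x + phi x) mulN1r addrC.
by rewrite mulrCA ger_pMr// ler_pdivrMr// mul1r lerDl.
Qed.

(** If the pairing with f is a bounded functional, it is 0 by dual_eq0;
    otherwise embed is 0 by default. *)
Lemma embed_eq0 (f : 'rV[R]_d -> R) :
  (forall phi, Cc w phi -> \int[leb_on w]_x (f x * phi x) = 0) -> embed w f = 0.
Proof.
move=> f0; rewrite /embed /insubd; case: insubP => [m _ mE|]//=.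
by apply: dual_eq0 => phi /f0 <-; rewrite -[LHS]/(val m phi) mE.
Qed.

End dual.

(** * Lq norms *)

Section Lnorm_extra.
Context dT (T : measurableType dT) (R : realType) (mu : {measure set T -> \bar R}).

Lemma measurable_normpow (f : T -> R) (q : R) : measurable_fun setT f ->
  measurable_fun setT (fun x => (`|(EFin \o f) x| `^ q)%E).
Proof.
move=> mf; apply/(measurableT_comp (measurable_poweR q)).
by apply: measurableT_comp => //; exact/measurable_EFinP.
Qed.

Lemma ae_eq_Lnorm (f g : T -> R) (q : R) :
  measurable_fun setT f -> measurable_fun setT g -> f = g %[ae mu] ->
  ('N[mu]_q%:E[EFin \o f] = 'N[mu]_q%:E[EFin \o g])%E.
Proof.
move=> mf mg fg; rewrite unlock /Lnorm; congr (_ `^ _)%E.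
apply: ge0_ae_eq_integral => //.
- exact: measurable_normpow.
- exact: measurable_normpow.
- by move=> x _; exact: poweR_ge0.
- by move=> x _; exact: poweR_ge0.
by apply: filterS fg => x fgx _; rewrite /= fgx.
Qed.

Lemma Lnorm_sum_le (I : Type) (r : seq I) (P : pred I) (F : I -> T -> R) (q : R) :
  1 <= q -> (forall i, P i -> measurable_fun setT (F i)) ->
  measurable_fun setT (\sum_(i <- r | P i) F i) /\
  ('N[mu]_q%:E[EFin \o (\sum_(i <- r | P i) F i)%R] <=
   \sum_(i <- r | P i) 'N[mu]_q%:E[EFin \o F i])%E.
Proof.
move=> q1 mF; elim: r => [|i r [mS IH]].
  rewrite !big_nil; split; first exact: measurable_cst.
  by rewrite (Lnorm0 mu)// gt_eqF// lte_fin (lt_le_trans ltr01).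
rewrite !big_cons; case: ifPn => Pi //; split.
  by apply: measurable_funD => //; exact: mF.
apply: (le_trans (eminkowski _ _ _ _)) => //; first exact: mF.
by rewrite leeD2l.
Qed.

(** Hoelder's inequality for |f|^q and 1 with exponent 2 / q, and its conjugate;
    for q = 2, where that exponent degenerates, the constant is 1. *)
Lemma Lnorm_le_Lnorm2 (q : R) : (mu setT < +oo)%E -> 1 < q <= 2 ->
  exists2 C : R, 0 <= C & forall f : T -> R, measurable_fun setT f ->
    ('N[mu]_q%:E[EFin \o f] <= C%:E * 'N[mu]_2%:E[EFin \o f])%E.
Proof.
move=> muT /andP[q1]; rewrite le_eqVlt => /predU1P[->|q2].
  by exists 1 => // f mf; rewrite mul1e.
have q0 : 0 < q by rewrite (lt_trans ltr01).
have qN0 : q != 0 by rewrite gt_eqF.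
pose r := 2 / q; pose r' := (1 - r^-1)^-1.
have r0 : 0 < r by rewrite divr_gt0.
have r'0 : 0 < r'.
  by rewrite invr_gt0 subr_gt0 /r invf_div ltr_pdivrMr// mul1r.
have rr' : r^-1 + r'^-1 = 1 by rewrite /r' invrK subrKC.
have muK : (mu setT `^ r'^-1)%E \is a fin_num.
  by apply: fin_num_poweR; rewrite ge0_fin_numE.
exists (fine (mu setT `^ r'^-1) `^ q^-1) => [|f mf]; first exact: powR_ge0.
have mfq : measurable_fun setT (fun x => `|f x| `^ q).
  by apply: (measurableT_comp (measurable_powR q)); exact: measurableT_comp.
have := hoelder mu mfq (measurable_cst (1 : R)) r0 r'0 rr'.
rewrite Lnorm_cst1 Lnorm1.
have -> : (\int[mu]_x `|(EFin \o ((fun x => `|f x| `^ q) \* cst 1)%R) x| =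
    'N[mu]_q%:E[EFin \o f] `^ q)%E.
  rewrite poweR_Lnorm//; apply: eq_integral => x _ /=.
  by rewrite mulr1 ger0_norm// powR_ge0.
have -> : ('N[mu]_r%:E[EFin \o (fun x => (`|f x| `^ q)%R)] = 'N[mu]_2%:E[EFin \o f] `^ q)%E.
  rewrite unlock /Lnorm -poweRrM /r invf_div (mulrC 2^-1); congr (_ `^ _)%E.
  apply: eq_integral => x _ /=.
  by rewrite ger0_norm ?powR_ge0// -powRrM mulrCA mulfV// mulr1.
rewrite -(fineK muK) => h.
have qK (x : \bar R) : (0 <= x)%E -> ((x `^ q) `^ q^-1)%E = x.
  by move=> x0; rewrite -poweRrM mulfV// poweRe1.
have Nq0 : (0 <= 'N[mu]_q%:E[EFin \o f])%E by exact: Lnorm_ge0.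
have N20 : (0 <= 'N[mu]_2%:E[EFin \o f])%E by exact: Lnorm_ge0.
have K0 : (0 <= (fine (mu setT `^ r'^-1))%:E)%E by rewrite lee_fin fine_ge0// poweR_ge0.
rewrite -[leLHS]qK// -[X in (_ * X)%E]qK// muleC -poweR_EFin -poweRM ?poweR_ge0//.
apply: gt0_ler_poweR => //.
- by rewrite invr_ge0 ltW.
- by rewrite in_itv/= poweR_ge0 leey.
- by rewrite in_itv/= mule_ge0 ?poweR_ge0 ?leey.
Qed.

End Lnorm_extra.

(** * Convolution of a measure with an L2 function *)

Section conv_bound.
Context (R : realType) (d : nat) (w Sigma : openSet R d).
Context (bw : bounded_set (w : set 'rV[R]_d)).
Context (bS : bounded_set (Sigma : set 'rV[R]_d)).

Lemma Cc_continuous phi : Cc w phi -> continuous phi. Proof. by case. Qed.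

Lemma Cc_measurable phi : Cc w phi -> measurable_fun setT phi.
Proof. by move=> /Cc_continuous cf; exact: continuous_measurable_rV. Qed.

Lemma Cc_bounded phi : Cc w phi -> exists c, forall x, `|phi x| <= c.
Proof.
move=> Cphi; have C0phi : phi \in C0_pred w.
  by rewrite inE => e e0; exists phi => // x; rewrite subrr normr0 ltW.
exact: (C0_bounded (MkC0 C0phi)).
Qed.

Lemma Cc_out phi : Cc w phi -> forall x, ~ open_carrier w x -> phi x = 0.
Proof.
move=> [_ _ sphi] x wx; apply: contrapT => /eqP phix; apply: wx.
by apply: sphi; exact: subset_closure.
Qed.

Lemma Cc_Lfun2 phi : Cc w phi -> phi \in Lfun (leb_on w) 2%:E.
Proof.
move=> Cphi; have [c phic] := Cc_bounded Cphi.
by apply: (@bounded_Lfun2 _ _ _ _ _ c) => //; [exact: leb_on_finite|exact: Cc_measurable].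
Qed.

(** Young's inequality, up to the factor 2. For a test function phi,
    Cauchy-Schwarz and translation invariance bound y |-> int phi(x + y) g(x) dx
    uniformly by |phi| |g|; hence the pairing of m * g with phi is at most
    |m| |g| |phi|, and duality in L2(w) concludes. *)
Lemma is_conv_Lnorm2_le (m : dualC0 (diff_open w Sigma)) (g f : 'rV[R]_d -> R) :
  g \in Lfun (leb_on Sigma) 2%:E -> is_conv m g f ->
  ('N[leb_on w]_2%:E[EFin \o f] <=
    (2 * (dual_norm m * fine ('N[leb_on Sigma]_2%:E[EFin \o g])))%:E)%E.
Proof.
move=> Lg [Lf fphi]; set ng := fine _.
have ng0 : 0 <= ng by rewrite fine_ge0// Lnorm_ge0.
have [Cc0 CcD] := Cc_submod w.
apply: (@Lnorm2_le_dual_bound _ _ _ _ (Cc w)) => //.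
- exact: leb_on_finite.
- exact: Cc_Lfun2.
- exact: l2_closure_Cc.
- by apply: Lf; rewrite lexx andbT ltr1n.
- by rewrite mulr_ge0// dual_norm_ge0.
move=> phi Cphi; have [psi psiE ->] := fphi _ Cphi.
rewrite -mulrA; apply: dual_norm_bound => y; rewrite psiE.
have mphi := Cc_measurable Cphi.
have mphiy : measurable_fun setT (fun x : 'rV[R]_d => phi (x + y)).
  by apply: (measurableT_comp mphi); exact: measurable_shift_rV.
have Lphiy : (fun x : 'rV[R]_d => phi (x + y)) \in Lfun (leb_on Sigma) 2%:E.
  have [c phic] := Cc_bounded Cphi.
  by apply: (@bounded_Lfun2 _ _ _ _ _ c) => //; exact: leb_on_finite.
apply: (le_trans (cauchy_schwarz Lphiy Lg)); rewrite mulrC -/ng ler_wpM2l//.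
apply: fine_le; rewrite ?Lfun_fin//; first exact: Cc_Lfun2.
rewrite !Lnorm2E lee_sqrt ?sqint_ge0//; apply: sqint_shift_le => //.
exact: Cc_out.
Qed.

(** When no function represents the convolution, conv is 0 by default and the
    bound is trivial. *)
Lemma conv_Lnorm2_le (m : dualC0 (diff_open w Sigma)) (g : 'rV[R]_d -> R) :
  g \in Lfun (leb_on Sigma) 2%:E -> ('N[leb_on Sigma]_2%:E[EFin \o g] <= 1)%E ->
  measurable_fun setT (Defs.conv m g) /\
  ('N[leb_on w]_2%:E[EFin \o Defs.conv m g] <= (2 * dual_norm m)%:E)%E.
Proof.
move=> Lg g1; rewrite /Defs.conv; case: xgetP => [f fE fconv|_]; last first.
  split; first exact: measurable_cst.
  by rewrite (Lnorm0 (leb_on w))// lee_fin mulr_ge0// dual_norm_ge0.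
have [Lf _] := fconv; split.
  by apply: (@Lfun_measurable _ _ _ (leb_on w) 2%:E); apply: Lf; rewrite lexx andbT ltr1n.
apply: (le_trans (is_conv_Lnorm2_le Lg fconv)); rewrite lee_fin ler_wpM2l//.
rewrite ler_piMr ?dual_norm_ge0//.
by rewrite -lee_fin fineK// Lfun_fin.
Qed.

Lemma is_conv0 : is_conv (0 : dualC0 (diff_open w Sigma)) 0 0.
Proof.
split=> [q hq|phi Cphi]; first exact: (Lfun_addr_closed _ (exponent_ge1 hq)).1.
exists 0 => [y|].
  rewrite /Rintegral (_ : \int[_]_x _ = 0)%E//.
  by apply: integral0_eq => x _; rewrite mulr0.
rewrite /Rintegral (_ : \int[_]_x _ = 0)%E//.
by apply: integral0_eq => x _; rewrite mul0r.
Qed.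

(** The value selected by conv need not be the zero function, only one that
    integrates to 0 against Cc(w). *)
Lemma conv0 : is_conv (0 : dualC0 (diff_open w Sigma)) 0
  (Defs.conv (0 : dualC0 (diff_open w Sigma)) 0).
Proof. by rewrite /Defs.conv; case: xgetP => // /(_ _ is_conv0). Qed.

End conv_bound.

(** * The network *)

Section network.
Context (R : realType) (d : nat) (Omega Sigma : openSet R d).
Context (bO : bounded_set (Omega : set 'rV[R]_d)).
Context (bS : bounded_set (Sigma : set 'rV[R]_d)).
Context (L : nat) (N : nat -> nat)
  (E : forall l : 'I_L.+1, {set 'I_(width N l.+1) * 'I_(width N l)}).

Lemma bounded_layer l : bounded_set (layer Omega Sigma l : set 'rV[R]_d).
Proof.
elim: l => [//|l [M [Mr lM]]]; have [K [Kr SK]] := bS.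
exists (`|M| + 1 + (`|K| + 1)); split; first exact: num_real.
move=> r rMK _ [x lx [y Sy <-]] /=; apply: le_trans (ltW rMK).
apply: (le_trans (ler_normB _ _)); apply: lerD.
  by apply: lM => //; rewrite (le_lt_trans (ler_norm _)) ?ltrDl.
by apply: SK => //; rewrite (le_lt_trans (ler_norm _)) ?ltrDl.
Qed.

Definition zero_measures : measures Omega Sigma L N := fun=> 0.

(** Each edge contributes a function that pairs to 0 with Cc. Over a bounded
    layer all these functions and the test functions are in L2, so that the
    pairing is additive and the sum pairs to 0 as well. *)
Lemma layer_conv0 (l : 'I_L.+1) (k : 'I_(width N l)) :
  let f := layer_conv zero_measures (0 : Theta Sigma E) k in
  (forall q, 1 < q <= 2 -> f \in Lfun (leb_on (layer Omega Sigma l)) q%:E) /\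
  embed (layer Omega Sigma l) f = 0.
Proof.
set w := layer Omega Sigma l; set f := layer_conv _ _ _ => /=.
have h2 : 1 < (2 : R) <= 2 by rewrite lexx andbT ltr1n.
suff [fq f0] : (forall q, 1 < q <= 2 -> f \in Lfun (leb_on w) q%:E) /\
    (forall phi, Cc w phi -> \int[leb_on w]_x (f x * phi x) = 0).
  by split=> //; exact: embed_eq0.
rewrite /f /layer_conv.
apply: (big_ind (fun f : 'rV[R]_d -> R =>
    (forall q, 1 < q <= 2 -> f \in Lfun (leb_on w) q%:E) /\
    (forall phi, Cc w phi -> \int[leb_on w]_x (f x * phi x) = 0))).
- have [f0 f0phi] := is_conv0 w Sigma; split=> // phi /f0phi[psi _ ->] //.
- move=> u v [uq u0] [vq v0]; split=> [q hq|phi Cphi].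
    by apply: (Lfun_addr_closed _ (exponent_ge1 hq)).2; [exact: uq|exact: vq].
  have Lphi := Cc_Lfun2 (bounded_layer l) Cphi.
  have /Lfun1_integrable uphi := Lfun2_mul_Lfun1 (uq _ h2) Lphi.
  have /Lfun1_integrable vphi := Lfun2_mul_Lfun1 (vq _ h2) Lphi.
  rewrite -[RHS]addr0 -{1}(u0 _ Cphi) -(v0 _ Cphi) -RintegralD//.
  by apply: eq_Rintegral => x _; rewrite -mulrDl.
move=> e _; have -> : zero_measures l (val e).1 = 0 by rewrite ffunE.
have -> : (0 : Theta Sigma E) (Tagged (edge E) e) = 0 by rewrite ffunE.
have [cq cphi] := conv0 w Sigma.
by split=> // phi /cphi[psi _ ->].
Qed.

End network.

(** * Bounds on the prior *)

Section coercivity.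
Context (R : realType) (d : nat) (Omega Sigma : openSet R d).
Context (bO : bounded_set (Omega : set 'rV[R]_d)).
Context (bS : bounded_set (Sigma : set 'rV[R]_d)).
Context (L : nat) (N : nat -> nat)
  (E : forall l : 'I_L.+1, {set 'I_(width N l.+1) * 'I_(width N l)})
  (Nc : nat) (Z : {linear Theta Sigma E -> 'rV[R]_Nc})
  (J : penalties Omega Sigma L N).
Context (J_ge0 : forall (l : 'I_L) m, (0 <= @J l m)%E).

Lemma dual_norm_le_energy (m : measures Omega Sigma L N) (theta : Theta Sigma E)
    (l : 'I_L.+1) (n : 'I_(width N l.+1)) :
  ((dual_norm (m l n))%:E <= energy J m theta)%E.
Proof.
have dn0 l' n' : (0 <= (dual_norm (m l' n'))%:E)%E by rewrite lee_fin dual_norm_ge0.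
rewrite /energy (bigD1 l)//= (bigD1 n)//= -!addeA leeDl//.
rewrite !adde_ge0//.
- by apply: sume_ge0 => n' _; exact: dn0.
- by apply: sume_ge0 => l' _; apply: sume_ge0 => n' _; exact: dn0.
- by apply: sume_ge0 => l' _; exact: J_ge0.
Qed.

(** The output is a finite sum of convolutions, one for each edge of the first
    layer; each is bounded by the norm of a measure of that layer, hence by the
    energy. The final + 1 makes the constant positive even without edges. *)
Lemma feasible_norm_le (q : R) : 1 < q <= 2 ->
  exists2 C : R, 0 < C & forall (v : 'rV[R]_d -> R) p,
    measurable_fun setT v -> feasible Z v p ->
    (Lq_norm Omega q v <= C%:E * energy J p.1 p.2)%E.
Proof.
move=> hq; have [C C0 qC] := Lnorm_le_Lnorm2 (leb_on_finite bO) hq.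
pose P (e : edge E ord0) := (val e).2 == (ord0 : 'I_1).
exists (\sum_(e | P e) (2 * C) + 1).
  by rewrite ltr_wpDl// sumr_ge0// => e _; rewrite mulr_ge0.
move=> v [m theta] mv [/= vE theta1 _].
set G := energy J m theta.
have q1 : 1 <= q by case/andP: hq => /ltW.
have convE (e : edge E ord0) := @conv_Lnorm2_le R d Omega Sigma bO bS
  (m ord0 (val e).1) (theta (Tagged (edge E) e)) (LfunP _) (theta1 _).
have [mS NS] := @Lnorm_sum_le _ _ R (leb_on Omega) _ (index_enum _) P
  (fun e : edge E ord0 =>
    Defs.conv (m ord0 (val e).1) (theta (Tagged (edge E) e)) : 'rV[R]_d -> R) q q1
  (fun e _ => (convE e).1).
rewrite /Lq_norm (ae_eq_Lnorm q mv _ vE)//; apply: (le_trans NS).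
have G0 : (0 <= G)%E.
  rewrite /G /energy adde_ge0//; last by apply: sume_ge0.
  by apply: sume_ge0 => l _; apply: sume_ge0 => n _; rewrite lee_fin dual_norm_ge0.
apply: (@le_trans _ _ (\sum_(e | P e) (2 * C)%:E * G)%E).
  apply: lee_sum => e _.
  have [mc cN] := convE e; apply: (le_trans (qC _ mc)).
  apply: (le_trans (lee_wpmul2l _ cN)); first by rewrite lee_fin.
  rewrite -EFinM mulrCA mulrA (EFinM (2 * C)).
  apply: lee_wpmul2l; first by rewrite lee_fin mulr_ge0.
  exact: (@dual_norm_le_energy m theta ord0 (val e).1).
rewrite -ge0_sume_distrl => [|e _]; last by rewrite lee_fin mulr_ge0.
by rewrite sumEFin lee_wpmul2r// lee_fin lerDl.
Qed.

Lemma prior_coercive (q : R) (v : nat -> 'rV[R]_d -> R) : 1 < q <= 2 ->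
  (forall n, measurable_fun setT (v n)) ->
  Lq_norm Omega q (v m) @[m --> \oo] --> +oo%E ->
  prior J Z (v m) @[m --> \oo] --> +oo%E.
Proof.
move=> hq mv voo; have [C C0 vC] := feasible_norm_le hq.
have {}vC n : (Lq_norm Omega q (v n) <= C%:E * prior J Z (v n))%E.
  rewrite -lee_pdivrMl//; apply: le_ereal_inf_tmp => _ [p pv <-].
  by rewrite lee_pdivrMl//; exact: vC.
apply/cvgeyPge => A; have /cvgeyPge/(_ (C * A)) := voo.
apply: filterS => n CA; rewrite -(@lee_pmul2l _ C%:E)//.
by rewrite -EFinM (le_trans CA).
Qed.

(** The witness is the output of the network with zero measures and zero
    weights. It vanishes almost everywhere, but taking this very function as v
    makes the pair feasible by reflexivity; all residuals are 0. *)
Lemma prior_proper (q : R) (hq : 1 < q <= 2) : (forall l : 'I_L, @J l 0 = 0%E) ->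
  exists v : Lq Omega (exponent_ge1 hq), prior J Z v <> +oo%E.
Proof.
move=> J0.
pose z := @zero_measures R d Omega Sigma L N.
have [Lf _] := layer_conv0 bO bS E (ord0 : 'I_(width N (ord0 : 'I_L.+1))).
exists (Lfun_Sub (exponent_ge1 hq) (Lf q hq)).
suff h : (prior J Z (Lfun_Sub (exponent_ge1 hq) (Lf q hq)) <= 0)%E.
  by move=> h'; rewrite h' in h.
apply: ereal_inf_lbound; exists (z, 0) => /=.
  split => /=.
  - by apply/nearW => x; rewrite -[LHS]/(layer_conv z (0 : Theta Sigma E) _ x).
  - move=> e; rewrite ffunE /Lq_norm (Lnorm0 (leb_on Sigma))//.
  - exact: linear0.
rewrite /energy !big1 ?adde0// => l _.
  rewrite (_ : residual _ _ _ = 0)//; apply/ffunP => k; rewrite !ffunE.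
  have [_ ->] := layer_conv0 bO bS E
    (k : (fun l : 'I_L.+1 => 'I_(width N l)) (outer l)).
  by rewrite subr0.
apply: big1 => n _; rewrite /z ffunE; congr EFin.
apply/eqP; rewrite eq_le dual_norm_ge0 andbT.
by apply: sup_le_ub => [|_ [phi _ <-]]; [exists `|0 : R|, 0 => // x; rewrite normr0|rewrite normr0].
Qed.

End coercivity.

Theorem lemma2p8 (R : realType) (d : nat) (Omega Sigma : openSet R d)
  (hOmega : bounded_domain Omega) (hSigma : bounded_domain Sigma)
  (hSigma0 : open_carrier Sigma 0)
  (L : nat) (N : nat -> nat)
  (E : forall l : 'I_L.+1, {set 'I_(width N l.+1) * 'I_(width N l)})
  (hE : forall (l : 'I_L.+1) (n : 'I_(width N l.+1)),
     exists k : 'I_(width N l), (n, k) \in E l)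
  (Nc : nat) (Z : {linear Theta Sigma E -> 'rV[R]_Nc}) (hZ : bounded_op Z)
  (J : penalties Omega Sigma L N)
  (J_ge0 : forall (l : 'I_L) m, (0 <= J l m)%E)
  (J_lsc : forall l : 'I_L, weak_star_lsc (J l))
  (J_0 : forall l : 'I_L, J l 0 = 0%E)
  (q : R) (hq : 1 < q <= 2) :
  (exists v : Lq Omega (exponent_ge1 hq), prior J Z v <> +oo%E) /\
  (forall v : nat -> Lq Omega (exponent_ge1 hq),
     Lq_norm Omega q (v m) @[m --> \oo] --> +oo%E ->
     prior J Z (v m) @[m --> \oo] --> +oo%E).
Proof.
have [bO _ _] := hOmega; have [bS _ _] := hSigma.
split; first exact: prior_proper.
by move=> v; exact: prior_coercive.
Qed.
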